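(* Let $T>0$, let $m\ge 1$, let $\alpha_0>\alpha_1>\cdots>\alpha_m\ge 0$ be real numbers, and let $n_i$ be the nonnegative integer with $n_i-1<\alpha_i\le n_i$ ($i=0,\dots,m$). Assume that $n_0>n_1$ and $a_i\in C[0,T]$ for $i=1,\dots,m$. With $H_j=\{i\in\{1,\dots,m\}:0\le\alpha_i\le j\}$, assume that $n_0\ge2$ and that there exists $j_0\in\{0,1,\dots,n_0-2\}$ such that $H_{j_0}=\emptyset$ and $H_{j_0+1}\ne\emptyset$; for $j\ge j_0+1$ put $h_j=\min H_j$. Let $b_0,\dots,b_{n_0-1}\in\mathbb R$. Then the initial value problem $${}^cD_{0+}^{\alpha_0}y(t)=-\sum_{i=1}^m a_i(t)\,{}^cD_{0+}^{\alpha_i}y(t),\quad 0<t<T;\qquad D^ky(t)|_{t=+0}=b_k,\quad k=0,1,\dots,n_0-1,$$ has a unique solution $y\in C^{\alpha_0,n_0-1}[0,T]$, and it is represented as $y(t)=\sum_{j=0}^{n_0-1}b_jy_j(t)$, where $y_j\in C^{\alpha_0,n_0-1}[0,T]$, $j=0,1,\dots,n_0-1$, is the canonical fundamental system of solutions of the equation ${}^cD_{0+}^{\alpha_0}y(t)=-\sum_{i=1}^m a_i(t)\,{}^cD_{0+}^{\alpha_i}y(t)$, $0<t<T$, given by $$y_j(t)=\Phi_{j+1}(t),\qquad j=0,1,\dots,j_0,$$ $$y_j(t)=\Phi_{j+1}(t)+\sum_{k=0}^\infty(-1)^{k+1}I_{0+}^{\alpha_0}\Big[\sum_{i=1}^m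 a_i(t)I_{0+}^{\alpha_0-\alpha_i}\Big]^k\sum_{i=h_j}^m a_i(t)\Phi_{j+1-\alpha_i}(t),\qquad j=j_0+1,\dots,n_1-1,$$ $$y_j(t)=\Phi_{j+1}(t)+\sum_{k=0}^\infty(-1)^{k+1}I_{0+}^{\alpha_0}\Big[\sum_{i=1}^m a_i(t)I_{0+}^{\alpha_0-\alpha_i}\Big]^k\sum_{i=1}^m a_i(t)\Phi_{j+1-\alpha_i}(t),\qquad j=n_1,n_1+1,\dots,n_0-1.$$
   Context: All functions are real valued. Riemann–Liouville integral: $I_{0+}^\alpha f(t)=\frac1{\Gamma(\alpha)}\int_0^t(t-\tau)^{\alpha-1}f(\tau)\,d\tau$ for $\alpha>0$, and $I^0_{0+}f=f$. Riemann–Liouville derivative: for $n-1<\alpha\le n$, $D_{0+}^\alpha f(t)=\frac{d^n}{dt^n}I_{0+}^{n-\alpha}f(t)$ for $t>0$ (with $D^0_{0+}f=f$). Caputo derivative: for $n-1<\alpha\le n$, ${}^cD_{0+}^\alpha f(t)=D_{0+}^\alpha\big[f(t)-\sum_{k=0}^{n-1}\frac{f^{(k)}(0)}{k!}t^k\big]$; in particular ${}^cD^0_{0+}f=f$. $D^k=d^k/dt^k$. $C^{\alpha_0,n_0-1}[0,T]$ is the space of functions $y\in C^{n_0-1}[0,T]$ with ${}^cD_{0+}^{\alpha_0}y\in C[0,T]$ (i.e. extending continuously to $[0,T]$). $\Phi_{\beta}(t)=t^{\beta-1}/\Gamma(\beta)$ for $\beta>0$; thus $\Phi_{j+1}(t)=t^j/j!$,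 and $\Phi_{j+1-\alpha_i}=D_{0+}^{\alpha_i}\Phi_{j+1}$ when $\alpha_i\le j$. The bracket $\big[\sum_i a_i(t)I_{0+}^{\alpha_0-\alpha_i}\big]^k$ is the $k$-th power (composition) of the operator $g\mapsto\sum_{i=1}^m a_i\cdot I_{0+}^{\alpha_0-\alpha_i}g$, the $0$-th power being the identity. The infinite series is the limit of its partial sums, for each $t\in[0,T]$. A range of indices $j$ whose lower bound exceeds its upper bound is empty. A canonical fundamental system of solutions of the equation is a system of solutions $y_0,\dots,y_{n_0-1}$ with $D^ky_j(t)|_{t=+0}=1$ if $k=j$ and $=0$ if $k\ne j$, for $k,j=0,1,\dots,n_0-1$. *)

(* Defs.v *)
From HB Require Import structures.
From mathcomp Require Import all_boot all_order all_algebra.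
From mathcomp Require Import all_classical all_reals all_analysis.

Set Implicit Arguments.
Unset Strict Implicit.
Unset Printing Implicit Defensive.

Import Order.TTheory GRing.Theory Num.Theory.
Import numFieldNormedType.Exports.

Local Open Scope ring_scope.
Local Open Scope classical_set_scope.

(** A function on [0, T] is represented by a total function [R -> R] of which
    only the values on [0, T] matter: the integrals below at [t] only read
    [f] on [0, t], and derivatives are only taken at points of ]0, T[. *)

Definition Gamma (R : realType) (x : R) : R :=
  \int[lebesgue_measure]_(s in `]0, +oo[) (s `^ (x - 1) * expR (- s)).

Definition Phi (R : realType) (beta t : R) : R := t `^ (beta - 1) / Gamma beta.

Definition RL_int (R : realType) (alpha : R) (f : R -> R) (t : R) : R :=
  if alpha == 0 then f t
  else (Gamma alpha)^-1 *
       \int[lebesgue_measure]_(tau in `[0, t]) ((t - tau) `^ (alpha - 1) * f tau).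

(** For [0 <= alpha], the natural number [n] with [n - 1 < alpha <= n]. *)
Definition frac_ord (R : realType) (alpha : R) : nat := `|Num.ceil alpha|%N.

Definition RL_der (R : realType) (alpha : R) (f : R -> R) : R -> R :=
  (RL_int ((frac_ord alpha)%:R - alpha) f)^`(frac_ord alpha).

(** [f^(k)(0)] for a function on [0, T], i.e. the derivative at [+0]. It is
    only meaningful when the limit exists, as it does for [k <= n] when
    [C_n T n f] (defined below). *)
Definition der_at0 (R : realType) (f : R -> R) (k : nat) : R :=
  lim (f^`(k) x @[x --> 0^'+]).

Definition sub_Taylor0 (R : realType) (n : nat) (f : R -> R) (t : R) : R :=
  f t - \sum_(0 <= k < n) der_at0 f k / k`!%:R * t ^+ k.

Definition Caputo (R : realType) (alpha : R) (f : R -> R) : R -> R :=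
  RL_der alpha (sub_Taylor0 (frac_ord alpha) f).

Definition extends_C0 (R : realType) (T : R) (g : R -> R) : Prop :=
  exists G : R -> R,
    {within `[0, T], continuous G} /\ (forall t, 0 < t < T -> g t = G t).

(** Existence of [f', ..., f^(n)] on ]0, T[; needed because [derive1n] is
    total. *)
Definition n_derivable (R : realType) (T : R) (n : nat) (f : R -> R) : Prop :=
  forall k, (k < n)%N -> forall t, 0 < t < T -> derivable (f^`(k)) t 1.

(** C^n[0, T]: [f] is continuous on [0, T], and its derivatives up to order
    [n] exist on ]0, T[ and extend continuously to [0, T]. *)
Definition C_n (R : realType) (T : R) (n : nat) (f : R -> R) : Prop :=
  [/\ {within `[0, T], continuous f},
      n_derivable T n f
    & forall k, (k <= n)%N -> extends_C0 T (f^`(k))].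

(** C^{alpha, n}[0, T]; the second clause says that the Caputo derivative of
    [f] exists on ]0, T[. *)
Definition C_Caputo (R : realType) (T alpha : R) (n : nat) (f : R -> R) : Prop :=
  [/\ C_n T n f,
      n_derivable T (frac_ord alpha)
        (RL_int ((frac_ord alpha)%:R - alpha)
                (sub_Taylor0 (frac_ord alpha) f))
    & extends_C0 T (Caputo alpha f)].

Definition solves_eq (R : realType) (T : R) (m : nat) (alpha : nat -> R)
    (a : nat -> R -> R) (y : R -> R) : Prop :=
  forall t, 0 < t < T ->
    Caputo (alpha 0%N) y t =
    - \sum_(1 <= i < m.+1) a i t * Caputo (alpha i) y t.

(** D^k y(t)|_{t=+0} = b_k for k < n. *)
Definition init_cond (R : realType) (n : nat) (b : nat -> R) (y : R -> R) : Prop :=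
  forall k, (k < n)%N -> y^`(k) t @[t --> 0^'+] --> b k.

Definition is_solution (R : realType) (T : R) (m : nat) (alpha : nat -> R)
    (n0 : nat) (a : nat -> R -> R) (b : nat -> R) (y : R -> R) : Prop :=
  [/\ C_Caputo T (alpha 0%N) n0.-1 y,
      solves_eq T m alpha a y
    & init_cond n0 b y].

Definition canonical_system (R : realType) (T : R) (m : nat) (alpha : nat -> R)
    (n0 : nat) (a : nat -> R -> R) (Y : nat -> R -> R) : Prop :=
  forall j, (j < n0)%N ->
    [/\ C_Caputo T (alpha 0%N) n0.-1 (Y j),
        solves_eq T m alpha a (Y j)
      & init_cond n0 (fun k => (k == j)%:R) (Y j)].

(** H_j = {i in {1..m} : 0 <= alpha_i <= j}, listed in increasing order. *)
Definition Hset (R : realType) (m : nat) (alpha : nat -> R) (j : nat) : seq nat :=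
  [seq i <- iota 1 m | 0 <= alpha i <= j%:R].

(** min H_j when H_j is nonempty: all its elements are at most [m], which is
    therefore neutral for the minimum. *)
Definition hmin (R : realType) (m : nat) (alpha : nat -> R) (j : nat) : nat :=
  \big[minn/m]_(i <- Hset m alpha j) i.

Definition bracket_op (R : realType) (m : nat) (alpha : nat -> R)
    (a : nat -> R -> R) (g : R -> R) (t : R) : R :=
  \sum_(1 <= i < m.+1) a i t * RL_int (alpha 0%N - alpha i) g t.

(** The [N]-th partial sum of
      Phi_{j+1}(t) + sum_{k >= 0} (-1)^{k+1} I^{alpha_0} [...]^k
                       sum_{i = h}^m a_i(t) Phi_{j+1-alpha_i}(t). *)
Definition fund_partial (R : realType) (m : nat) (alpha : nat -> R)
    (a : nat -> R -> R) (h j : nat) (t : R) (N : nat) : R :=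
  Phi j.+1%:R t +
  \sum_(0 <= k < N) (-1) ^+ k.+1 *
    RL_int (alpha 0%N)
      (iter k (bracket_op m alpha a)
         (fun s => \sum_(h <= i < m.+1) a i s * Phi (j.+1%:R - alpha i) s)) t.

(* Main.v *)
(** The Riemann-Liouville integrals [I^a] form a semigroup on continuous functions:
    their kernels [s^(a-1)] convolve to [B(a, b) s^(a+b-1)], and integrating against
    [e^(-s)] identifies [B(a, b)] with [Gamma a * Gamma b / Gamma (a + b)]. Hence
    [I^a f] is continuous and [(I^(a+1) f)' = I^a f] on ]0, oo[. It follows that a
    function [y] with initial values [b_k] and a continuous Caputo derivative [u]
    of order [alpha_0] is the same thing as
    [y = sum_l b_l I^l 1 + I^(alpha_0) u], and that then
    [cD^(alpha_i) y = sum_(l >= n_i) b_l I^(l - alpha_i) 1 + I^(alpha_0 - alpha_i) u].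
    The initial value problem thus becomes the Volterra equation [u = - F - B u]
    with [B = sum_i a_i I^(alpha_0 - alpha_i)]. In the norm [sup e^(-l t) |u t|] with
    [l] large, [B] has norm at most 1/2, so the equation has the unique solution
    [sum_k (-1)^(k+1) B^k F], and applying [I^(alpha_0)] termwise gives the formulas
    for the [y_j]. *)

Require Import Defs.
From mathcomp Require Import all_boot all_order all_algebra.
From mathcomp Require Import all_classical all_reals all_analysis.
From mathcomp Require Import measurable_realfun lra ring.

Set Implicit Arguments.
Unset Strict Implicit.
Unset Printing Implicit Defensive.

Import Order.TTheory GRing.Theory Num.Theory.
Import numFieldNormedType.Exports.

Local Open Scope ring_scope.
Local Open Scope classical_set_scope.

(** * Convolution *)

Section Convolution.
Context {R : realType}.
Local Notation mu := (@lebesgue_measure R).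
Local Open Scope ereal_scope.
Implicit Types f g h : R -> \bar R.

(** For [a < 1] the kernels s^(a-1) are singular at 0, and the convergence of the integrals is not
    known beforehand. Convolutions therefore take extended real values and are handled for
    nonnegative functions, where Tonelli's theorem and changes of variable ask only for
    measurability. Once Gamma is bounded by hand for arguments at most 1, its finiteness elsewhere,
    that of the Beta integrals and that of the fractional integrals all come from one identity,
    [egammaM]. A signed continuous function is split into two nonnegative continuous ones.

    The coefficients and the Caputo derivative are continuous on [[0, T]] only. Extending them by
    constants allows a calculus of [RL_int] for functions continuous on the whole line; since
    [RL_int] at [t] reads only [[0, t]], no value on [[0, T]] is affected.

    The delicate direction is the recovery of [y] from its Caputo derivative: [y] is only of class
    C^(n-1), so there is no n-th derivative to integrate. The identity is obtained after one
    integration too many, which a differentiation then undoes. *)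

Lemma measurable_affine (c d : R) :
  measurable_fun [set: R] (fun x : R => c * x + d)%R.
Proof.
by apply: measurable_funD => //; apply: measurable_funM.
Qed.

(** The right side is a measure, and on []a, b]] it has the right value because the preimage is
    again such an interval, of length divided by [c]. *)
Lemma lebesgue_measure_affine (c d : R) (A : set R) : (0 < c)%R -> measurable A ->
  mu A = c%:E * pushforward mu (fun x : R => c * x + d : measurableTypeR R)%R A.
Proof.
move=> c0 mA.
pose phi := fun x : measurableTypeR R => (c * x + d : measurableTypeR R)%R.
have mphi : measurable_fun [set: measurableTypeR R] phi.
  exact: measurable_affine.
pose nu : {measure set (measurableTypeR R) -> \bar R} := pushforward mu phi.
rewrite -[RHS]/(mscale (NngNum (ltW c0)) (nu mphi) A).
apply: lebesgue_measure_unique => //= _ [[a b]] _ <-.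
rewrite /mscale /= /pushforward /=.
have -> : phi @^-1` `]a, b] = `]((a - d) / c)%R, ((b - d) / c)%R]%classic.
  apply/seteqP; split=> x /=; rewrite !in_itv/= /phi
    ltr_pdivrMr // ler_pdivlMr // ltrBlDr lerBrDr mulrC //.
rewrite !lebesgue_measure_itv/= !lte_fin ltr_pM2r ?invr_gt0// ltrD2r.
case: ifPn => _; last by rewrite mule0.
rewrite -!EFinD -EFinM; congr EFin; field.
by rewrite gt_eqF.
Qed.

Lemma integral_affine (c d : R) f : (0 < c)%R ->
  measurable_fun [set: R] f -> (forall x, 0 <= f x) ->
  \int[mu]_x f x = c%:E * \int[mu]_x f (c * x + d)%R.
Proof.
move=> c0 mf f0.
pose phi := fun x : measurableTypeR R => (c * x + d : measurableTypeR R)%R.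
have mphi : measurable_fun [set: measurableTypeR R] phi.
  exact: measurable_affine.
pose nu : {measure set (measurableTypeR R) -> \bar R} := pushforward mu phi.
transitivity (\int[mscale (NngNum (ltW c0)) (nu mphi)]_x f x).
  by apply: eq_measure_integral => A mA _ /=; exact: lebesgue_measure_affine.
rewrite ge0_integral_mscale//; congr (_ * _).
by rewrite /= (ge0_integral_pushforward mphi).
Qed.

Lemma integral_shift (d : R) f :
  measurable_fun [set: R] f -> (forall x, 0 <= f x) ->
  \int[mu]_x f (x + d)%R = \int[mu]_x f x.
Proof.
move=> mf f0; rewrite [RHS](@integral_affine 1 d)// mul1e.
by apply: eq_integral => x _; rewrite mul1r.
Qed.

Lemma integral_reflect f :
  measurable_fun [set: R] f -> (forall x, 0 <= f x) ->
  \int[mu]_x f (- x)%R = \int[mu]_x f x.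
Proof.
move=> mf f0.
have mN : measurable_fun setT (-%R : measurableTypeR R -> measurableTypeR R).
  exact: oppr_measurable.
rewrite -[LHS](ge0_integral_pushforward mN mu measurableT)//.
by apply: eq_measure_integral => //= A mA AS; exact: lebesgue_measureN.
Qed.

(** With values in [\bar R], the integral is meaningful for nonnegative measurable arguments before
    any convergence is known. *)
Definition convol f g (t : R) := \int[mu]_s (f (t - s)%R * g s).

Lemma measurable_convol_kernel f g :
  measurable_fun [set: R] f -> measurable_fun [set: R] g ->
  measurable_fun [set: R * R] (fun z : R * R => f (z.1 - z.2)%R * g z.2).
Proof.
move=> mf mg; apply: emeasurable_funM.
  apply: (measurableT_comp mf); apply: measurable_funB.
    exact: measurable_fst.
  exact: measurable_snd.
by apply: (measurableT_comp mg); exact: measurable_snd.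
Qed.

Lemma convol_ge0 f g : (forall x, 0 <= f x) -> (forall x, 0 <= g x) ->
  forall x, 0 <= convol f g x.
Proof. by move=> f0 g0 x; apply: integral_ge0 => s _; exact: mule_ge0. Qed.

Lemma measurable_convol f g :
  measurable_fun [set: R] f -> measurable_fun [set: R] g ->
  (forall x, 0 <= f x) -> (forall x, 0 <= g x) ->
  measurable_fun [set: R] (convol f g).
Proof.
move=> mf mg f0 g0.
apply: (@measurable_fun_fubini_tonelli_F _ _ _ _ R mu
  (fun z : R * R => f (z.1 - z.2)%R * g z.2)).
  exact: measurable_convol_kernel.
by move=> z; exact: mule_ge0.
Qed.

(** Tonelli, then translation invariance of the inner integral. *)
Lemma integral_convol f g :
  measurable_fun [set: R] f -> measurable_fun [set: R] g ->
  (forall x, 0 <= f x) -> (forall x, 0 <= g x) ->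
  \int[mu]_t convol f g t = (\int[mu]_t f t) * \int[mu]_t g t.
Proof.
move=> mf mg f0 g0.
rewrite /convol.
rewrite (@fubini_tonelli _ _ _ _ R mu mu
  (fun z : R * R => f (z.1 - z.2)%R * g z.2)); last 2 first.
- exact: measurable_convol_kernel.
- by move=> z; exact: mule_ge0.
rewrite muleC -ge0_integralZr//; last exact: integral_ge0.
apply: eq_integral => s _ /=.
rewrite ge0_integralZr//.
  by rewrite muleC; congr (_ * _); rewrite (integral_shift (- s)).
apply: (measurableT_comp mf).
by apply: measurable_funB.
Qed.

(** Tonelli exchanges the two integrals; translating the inner variable by [r] brings out the
    convolution of [f] and [g] at [t - r]. *)
Lemma convolA f g h :
  measurable_fun [set: R] f -> measurable_fun [set: R] g ->
  measurable_fun [set: R] h ->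
  (forall x, 0 <= f x) -> (forall x, 0 <= g x) -> (forall x, 0 <= h x) ->
  forall t, convol f (convol g h) t = convol (convol f g) h t.
Proof.
move=> mf mg mh f0 g0 h0 t.
rewrite /convol.
have mft : measurable_fun [set: R] (fun s : R => f (t - s)%R).
  by apply: (measurableT_comp mf); exact: measurable_funB.
under eq_integral => s _.
  rewrite -ge0_integralZl//; last 2 first.
  - apply: emeasurable_funM => //; apply: (measurableT_comp mg).
    exact: measurable_funB.
  - by move=> r _; exact: mule_ge0.
  over.
rewrite (@fubini_tonelli _ _ _ _ R mu mu
  (fun z : R * R => f (t - z.1)%R * (g (z.1 - z.2)%R * h z.2))); last 2 first.
- apply: emeasurable_funM; last exact: measurable_convol_kernel.
  by apply: (measurableT_comp mft); exact: measurable_fst.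
- by move=> z; rewrite !mule_ge0.
apply: eq_integral => r _ /=.
under eq_integral do rewrite muleA.
have mgr : measurable_fun [set: R] (fun s : R => g (s - r)%R).
  by apply: (measurableT_comp mg); exact: measurable_funB.
rewrite ge0_integralZr//; last 2 first.
- exact: emeasurable_funM.
- by move=> x _; exact: mule_ge0.
congr (_ * _).
rewrite -(integral_shift r); last 2 first.
- exact: emeasurable_funM.
- by move=> x; exact: mule_ge0.
by apply: eq_integral => s _; congr (f _ * g _); ring.
Qed.

End Convolution.

(** * The Gamma function *)

Section GammaFunction.
Context {R : realType}.
Local Notation mu := (@lebesgue_measure R).
Implicit Types (f : R -> R) (a b x t : R).

(** The convolution of two functions cut off in this way sees only []0, t[], so integrals over
    [[0, t]] become convolutions on the whole line. *)
Definition causal f : R -> R := f \_ `]0, +oo[.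

Definition pker a : R -> R := causal (fun x => x `^ (a - 1)).

Lemma causalE f x : causal f x = if 0 < x then f x else 0.
Proof.
rewrite /causal patchE; case: ifPn => [|/negP].
  by rewrite inE/= in_itv/= andbT => ->.
by rewrite inE/= in_itv/= andbT => /negP/negbTE ->.
Qed.

Lemma measurable_causal f : measurable_fun [set: R] f ->
  measurable_fun [set: R] (causal f).
Proof.
move=> mf; apply: (iffLR (measurable_restrictT _ _)) => //.
exact: measurable_funTS.
Qed.

Lemma measurable_pker a : measurable_fun [set: R] (pker a).
Proof. exact: measurable_causal (@measurable_powR R (a - 1)). Qed.

Lemma pker_ge0 a x : 0 <= pker a x.
Proof. by rewrite /pker causalE; case: ifP => // _; exact: powR_ge0. Qed.

Lemma pker_scale a t x : 0 < t -> pker a (t * x) = t `^ (a - 1) * pker a x.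
Proof.
move=> t0; rewrite /pker !causalE pmulr_rgt0//; case: ifP => x0.
  by rewrite powRM ?ltW.
by rewrite mulr0.
Qed.

Local Open Scope ereal_scope.

Let E (f : R -> R) : R -> \bar R := EFin \o f.

Let mE f : measurable_fun [set: R] f -> measurable_fun [set: R] (fun x => (f x)%:E).
Proof. by move=> mf; exact/measurable_EFinP. Qed.

(** Homogeneity of the kernels under s = t s'. The constant, the convolution at 1, is the Beta
    integral B(a, b). *)
Lemma convol_pker a b t :
  convol (E (pker a)) (E (pker b)) t =
  convol (E (pker a)) (E (pker b)) 1%R * (pker (a + b) t)%:E.
Proof.
rewrite /convol /E /=; case: (ltP 0%R t) => t0; last first.
  (* The product with 0 is 0 even for an infinite constant, which is not excluded at this point. *)
  rewrite [pker (a + b) t]causalE ltNge t0/= mule0.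
  apply: integral0_eq => s _; rewrite /pker !causalE.
  case: ltP => [|_]; last by rewrite mul0e.
  rewrite subr_gt0 => st; case: ltP => [s0|_]; last by rewrite mule0.
  by move: (lt_trans s0 st); rewrite ltNge t0.
rewrite (@integral_affine _ t 0)//; last 2 first.
- apply: emeasurable_funM; last exact: mE (@measurable_pker _).
  apply: mE; apply: (measurableT_comp (@measurable_pker a)).
  exact: measurable_funB.
- by move=> x; rewrite mule_ge0// lee_fin pker_ge0.
have scale (s : R) : (pker a (t - (t * s + 0)) * pker b (t * s + 0) =
    t `^ (a - 1) * t `^ (b - 1) * (pker a (1 - s) * pker b s))%R.
  rewrite addr0 (_ : t - t * s = t * (1 - s))%R; last by ring.
  by rewrite !pker_scale//; ring.
under eq_integral do rewrite -EFinM scale EFinM.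
rewrite ge0_integralZl//; last 3 first.
- apply: mE; apply: measurable_funM; last exact: measurable_pker.
  by apply: (measurableT_comp (@measurable_pker a)); exact: measurable_funB.
- by move=> s _; rewrite lee_fin mulr_ge0// pker_ge0.
- by rewrite lee_fin mulr_ge0// powR_ge0.
rewrite muleA muleC; congr (_ * _).
rewrite /pker causalE t0 -EFinM; congr EFin.
have tD r r' : (t `^ r * t `^ r' = t `^ (r + r'))%R.
  by rewrite -powRD//; apply/implyP => _; rewrite gt_eqF.
rewrite -{1}[t]powRr1 ?ltW// !tD.
by congr (_ `^ _)%R; ring.
Qed.

(** [Gamma] is a real-valued integral, which defaults to 0 on divergence; in [\bar R], convergence
    becomes a statement to prove. *)
Definition egamma a : \bar R := \int[mu]_x (pker a x * expR (- x))%:E.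

Lemma measurable_pkerexp a l :
  measurable_fun [set: R] (fun x => pker a x * expR (- (l * x)))%R.
Proof.
apply: measurable_funM; first exact: measurable_pker.
apply: (measurableT_comp (@measurable_expR R)).
by apply: measurable_funN; exact: measurable_funM.
Qed.

Lemma measurable_egamma_kernel a :
  measurable_fun [set: R] (fun x => (pker a x * expR (- x))%:E).
Proof.
apply: mE; have := @measurable_pkerexp a 1.
by under eq_fun do rewrite mul1r.
Qed.

(** Since e^(-(t-s)) e^(-s) = e^(-t), the convolution of the two Gamma integrands at [t] is e^(-t)
    times that of the bare kernels, a multiple of [pker (a + b)]. Integrating over [t] gives the
    product. *)
Lemma egammaM a b :
  egamma a * egamma b = convol (E (pker a)) (E (pker b)) 1%R * egamma (a + b).
Proof.
pose e c := E (fun x => pker c x * expR (- x))%R.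
have me c : measurable_fun [set: R] (e c) by exact: measurable_egamma_kernel.
have e0 c x : 0 <= e c x by rewrite lee_fin mulr_ge0 ?pker_ge0 ?expR_ge0.
have gE c : egamma c = \int[mu]_x e c x by [].
rewrite !gE -integral_convol// -ge0_integralZl//.
- apply: eq_integral => t _.
  rewrite (_ : convol _ _ t = (expR (- t))%:E * convol (E (pker a)) (E (pker b)) t).
    by rewrite convol_pker muleCA /e /E /= -EFinM [in RHS]mulrC.
  rewrite /convol -ge0_integralZl//.
  + have expE (s : R) : (expR (- t) * (pker a (t - s) * pker b s) =
        pker a (t - s) * expR (- (t - s)) * (pker b s * expR (- s)))%R.
      rewrite (_ : - t = - (t - s) + - s)%R; last by ring.
      by rewrite expRD; ring.
    by apply: eq_integral => s _; rewrite /e /E /= -!EFinM expE.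
  + apply: emeasurable_funM; last exact: mE (@measurable_pker _).
    apply: mE; apply: (measurableT_comp (@measurable_pker a)).
    exact: measurable_funB.
  + by move=> s _; rewrite mule_ge0// lee_fin pker_ge0.
- exact: me.
- by apply: convol_ge0 => x; rewrite /E /= lee_fin pker_ge0.
Qed.

Lemma egamma_gt0 a : (0 < a)%R -> 0 < egamma a.
Proof.
move=> a0.
(* On [[1, 2]] one has x^(a-1) >= x^(-1) >= 1/2 for [a > 0], and e^(-x) >= e^(-2). *)
pose c : R := (2^-1 * expR (- 2))%R.
have c0 : (0 < c)%R by rewrite mulr_gt0// expR_gt0.
have low (x : R) : (1 <= x -> x <= 2 -> c <= pker a x * expR (- x))%R.
  move=> x1 x2; have x0 : (0 < x)%R by lra.
  apply: ler_pM; rewrite ?expR_ge0 ?invr_ge0 ?ler_expR ?lerN2//.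
  rewrite /pker causalE x0.
  apply: (@le_trans _ _ (x `^ (- 1))%R); last by apply: ler_powR => //; lra.
  by rewrite powR_inv1 ?(ltW x0)// lef_pV2 ?posrE.
apply: (@lt_le_trans _ _ (\int[mu]_(x in `[1%R, 2%R]) c%:E)).
  rewrite integral_cst//= lebesgue_measure_itv/= lte_fin ltr1n.
  by rewrite -EFinB -EFinM lte_fin mulr_gt0// subr_gt0 ltr1n.
apply: (@le_trans _ _ (\int[mu]_(x in `[1%R, 2%R]) (pker a x * expR (- x))%:E)).
  apply: ge0_le_integral => //.
  - by move=> x _; rewrite lee_fin ltW.
  - apply/measurable_funTS; exact: measurable_egamma_kernel.
  - by move=> x; rewrite /= in_itv/= => /andP[x1 x2]; rewrite lee_fin low.
apply: ge0_subset_integral => //.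
- exact: measurable_egamma_kernel.
- by move=> x _; rewrite lee_fin mulr_ge0 ?pker_ge0 ?expR_ge0.
Qed.

Lemma egamma1 : egamma 1 = 1.
Proof.
rewrite -[RHS](@integral_exponential_pdf R 1)//.
rewrite [RHS](_ : _ = \int[mu]_(x in `[0%R, +oo[) (expR (- x))%:E); last first.
  rewrite [RHS]integral_mkcond; apply: eq_integral => x _.
  rewrite restrict_EFin /exponential_pdf /= !patchE.
  by case: ifP => // _; rewrite mul1r mulN1r.
rewrite -integral_itv_obnd_cbnd; last first.
  apply/measurable_funTS; apply: mE; apply: (measurableT_comp (@measurable_expR R)).
  exact: oppr_measurable.
rewrite integral_mkcond; apply: eq_integral => x _.
rewrite restrict_EFin /pker /causal /= !patchE.
by case: ifP => // _; rewrite ?mul0r// subrr powRr0 mul1r.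
Qed.

(** The kernel may be unbounded at 0, so the integral is taken as the increasing limit of integrals
    over closed intervals that avoid 0, where x^a / a is an antiderivative. *)
Lemma pker_integral01 a : (0 < a)%R ->
  \int[mu]_(x in `]0%R, 1%R]) (pker a x)%:E <= (a^-1)%:E.
Proof.
move=> a0.
(* The shift by 2 keeps the left end strictly between 0 and 1 for every [n]. *)
have FTC n : \int[mu]_(x in `[n.+2%:R^-1%R, 1%R]) (pker a x)%:E =
    (a^-1 * 1 `^ a)%:E - (a^-1 * n.+2%:R^-1%R `^ a)%:E.
  have n1 : (n.+2%:R^-1 < 1 :> R)%R by rewrite invf_lt1// ltr1n.
  have n0 : (0 < n.+2%:R^-1 :> R)%R by rewrite invr_gt0.
  have cont_pow r (z : R) : (0 < z)%R -> {for z, continuous (fun x => x `^ r)%R}.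
    move=> z0; apply: differentiable_continuous.
    apply/derivable1_diffP; apply: derivable_powR.
    by rewrite in_itv/= z0.
  transitivity (\int[mu]_(x in `[n.+2%:R^-1%R, 1%R]) (x `^ (a - 1))%:E).
    apply: eq_integral => x; rewrite inE/= in_itv/= => /andP[nx _].
    by rewrite /pker causalE (lt_le_trans n0 nx).
  apply: (@continuous_FTC2 _ (fun x => x `^ (a - 1))%R
    (fun x => a^-1 * x `^ a)%R) => //.
  - apply: continuous_in_subspaceT => x; rewrite inE/= in_itv/= => /andP[nx _].
    by apply: cont_pow; exact: lt_le_trans nx.
  - split.
    + move=> x; rewrite in_itv/= => /andP[nx _]; apply: derivableM => //.
      by apply: derivable_powR; rewrite in_itv/= andbT (lt_trans n0 nx).
    + apply: cvg_at_right_filter; apply: cvgM; first exact: cvg_cst.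
      exact: cont_pow.
    + apply: cvg_at_left_filter; apply: cvgM; first exact: cvg_cst.
      exact: cont_pow.
  - move=> x; rewrite in_itv/= => /andP[nx _].
    have x0 : (0 < x)%R by exact: lt_trans nx.
    rewrite derive1Ml; last by apply: derivable_powR; rewrite in_itv/= x0.
    rewrite powR_derive1 ?in_itv/= ?x0//.
    by rewrite mulrA mulVf ?mul1r// gt_eqF.
have -> : `]0%R, 1%R]%classic = \bigcup_n `[n.+2%:R^-1%R, 1%R]%classic :> set R.
  apply/seteqP; split => x /=.
    rewrite in_itv/= => /andP[x0 x1].
    have [n nx] := ltr_add_invr x0; exists n => //=.
    rewrite in_itv/= x1 andbT ltW// (le_lt_trans _ nx)// add0r.
    by rewrite lef_pV2 ?posrE// ler_nat.
  move=> [n _] /=; rewrite !in_itv/= => /andP[nx ->]; rewrite andbT.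
  by apply: lt_le_trans nx; rewrite invr_gt0.
have h : \int[mu]_(x in `[n.+2%:R^-1%R, 1%R]) (pker a x)%:E @[n --> \oo] -->
    \int[mu]_(x in \bigcup_n `[n.+2%:R^-1%R, 1%R]) (pker a x)%:E.
  apply: ge0_nondecreasing_set_cvg_integral.
  - apply/nondecreasing_seqP => n; rewrite subsetEset.
    by apply: subset_itvr; rewrite bnd_simp lef_pV2 ?posrE// ler_nat.
  - by move=> n.
  - by move=> n; apply/measurable_funTS; exact: mE (@measurable_pker _).
  - by move=> n x _; rewrite lee_fin pker_ge0.
rewrite -(cvg_lim _ h)//; apply: lime_le; first exact: (cvgP _ h).
near=> n; rewrite FTC powR1 mulr1 -EFinB lee_fin lerBlDr lerDl.
by rewrite mulr_ge0 ?powR_ge0// invr_ge0 ltW.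
Unshelve. all: by end_near. Qed.


(** For arguments at most 1, the integrand is dominated by the kernel on []0, 1]] and by e^(-x)
    beyond. Larger arguments are reached by doubling: in [egammaM] at [a / 2], the left side is
    finite and nonzero, so the Beta factor is nonzero and [egamma a] cannot be infinite. *)
Lemma egamma_lty a : (0 < a)%R -> egamma a < +oo.
Proof.
have base c : (0 < c <= 1)%R -> egamma c < +oo.
  move=> /andP[c0 c1].
  have dom (x : R) : (pker c x * expR (- x) <=
      (pker c \_ `]0%R, 1%R]) x + pker 1 x * expR (- x))%R.
    rewrite patchE.
    have [x0|x0] := leP x 0%R.
      by rewrite {1 3}/pker !causalE ltNge x0/= !mul0r addr0; case: ifP;
        rewrite // pker_ge0.
    case: ifPn => [|/negP]; rewrite inE/= in_itv/= x0/=.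
      move=> x1; rewrite -[leLHS]addr0 lerD ?mulr_ge0 ?pker_ge0 ?expR_ge0//.
      by rewrite ler_piMr ?pker_ge0// -expR0 ler_expR oppr_le0 ltW.
    move=> /negP; rewrite -ltNge => x1; rewrite add0r ler_wpM2r ?expR_ge0//.
    rewrite /pker !causalE x0; apply: ler_powR; first exact: ltW.
    by rewrite lerD2r.
  have mr : measurable_fun [set: R] (pker c \_ `]0%R, 1%R]).
    apply: (iffLR (measurable_restrictT _ _)) => //.
    exact: measurable_funTS (@measurable_pker _).
  have r0 x : 0 <= ((pker c \_ `]0%R, 1%R]) x)%:E.
    by rewrite lee_fin patchE; case: ifP; rewrite // pker_ge0.
  apply: (@le_lt_trans _ _ (\int[mu]_x (((pker c \_ `]0%R, 1%R]) x)%:E +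
      (pker 1 x * expR (- x))%:E))).
    apply: ge0_le_integral => //.
    - by move=> x _; rewrite lee_fin mulr_ge0 ?pker_ge0 ?expR_ge0.
    - exact: measurable_egamma_kernel.
    - by apply: emeasurable_funD; [exact: mE|exact: measurable_egamma_kernel].
    - by move=> x _; rewrite -EFinD lee_fin dom.
  rewrite ge0_integralD//=; last 3 first.
  - exact: mE.
  - by move=> x _; rewrite lee_fin mulr_ge0 ?pker_ge0 ?expR_ge0.
  - exact: measurable_egamma_kernel.
  rewrite -/(egamma 1) egamma1.
  rewrite (_ : \int[mu]_x ((pker c \_ `]0%R, 1%R]) x)%:E =
      \int[mu]_(x in `]0%R, 1%R]) (pker c x)%:E); last first.
    by rewrite [RHS]integral_mkcond; apply: eq_integral => x _; rewrite restrict_EFin.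
  by rewrite (@le_lt_trans _ _ ((c^-1)%:E + 1))// ?leeD2r ?pker_integral01// ltry.
move=> a0; have [n an] : exists n, (a <= 2 ^+ n)%R.
  by exists (Num.Def.archi_bound a); apply/ltW/upper_nthrootP.
elim: n a a0 an => [|n IH] a a0 an; first by apply: base; rewrite a0.
have h0 : (0 < a / 2)%R by rewrite divr_gt0.
have /IH/(_ _) hy : (0 < a / 2)%R by rewrite divr_gt0.
have {hy} : egamma (a / 2) < +oo by apply: hy; rewrite ler_pdivrMr// -exprSr.
have := egamma_gt0 h0; have := egammaM (a / 2) (a / 2); rewrite -splitr.
case: (egamma (a / 2)) => // g; rewrite -EFinM lte_fin => + g0 _.
rewrite ltey; have := egamma_gt0 a0; case: (egamma a) => // _.
set B := convol _ _ _; have : 0 <= B.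
  by apply: convol_ge0 => x; rewrite /E /= lee_fin pker_ge0.
rewrite le_eqVlt => /predU1P[<-|B0].
  by rewrite mul0e => -[/eqP]; rewrite gt_eqF// mulr_gt0.
by rewrite gt0_muley.
Qed.

Lemma egammaE a : egamma a = \int[mu]_(x in `]0%R, +oo[) (x `^ (a - 1) * expR (- x))%:E.
Proof.
rewrite [RHS]integral_mkcond; apply: eq_integral => x _.
rewrite restrict_EFin /pker /causal /= !patchE.
by case: ifP => // _; rewrite mul0r.
Qed.

Lemma EFin_Gamma a : (0 < a)%R -> (Gamma a)%:E = egamma a.
Proof.
move=> a0; rewrite /Gamma /Rintegral -egammaE fineK//.
by rewrite ge0_fin_numE ?egamma_lty// ltW// egamma_gt0.
Qed.

Lemma Gamma_gt0 a : (0 < a)%R -> (0 < Gamma a)%R.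
Proof. by move=> a0; rewrite -lte_fin EFin_Gamma// egamma_gt0. Qed.

Lemma Gamma_neq0 a : (0 < a)%R -> (Gamma a != 0)%R.
Proof. by move=> /Gamma_gt0; rewrite lt0r => /andP[]. Qed.

(** Multiplied by [Gamma a], a fractional integral is a convolution in [\bar R]; this cancellation
    brings identities proved there back to [R]. *)
Lemma Gamma_mulI a x y : (0 < a)%R ->
  (Gamma a * x)%:E = (Gamma a * y)%:E -> x = y.
Proof. by move=> /Gamma_neq0 a0 [] /(mulfI a0). Qed.

Lemma Gamma1 : Gamma 1%R = 1%R :> R.
Proof. by apply: EFin_inj; rewrite EFin_Gamma// egamma1. Qed.

(** [egammaM] solved for the Beta integral, which cannot be infinite: its product with the positive
    [Gamma (a + b)] is finite. *)
Lemma convol_pkerE a b t : (0 < a)%R -> (0 < b)%R ->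
  convol (EFin \o pker a) (EFin \o pker b) t =
  (Gamma a * Gamma b / Gamma (a + b) * pker (a + b) t)%:E.
Proof.
move=> a0 b0; have ab0 : (0 < a + b)%R by rewrite addr_gt0.
rewrite convol_pker EFinM; congr (_ * _).
have := egammaM a b; rewrite -!EFin_Gamma// -/E.
have := Gamma_gt0 ab0; have := Gamma_gt0 a0; have := Gamma_gt0 b0.
set B := convol _ _ _; have : 0 <= B.
  by apply: convol_ge0 => x; rewrite /E /= lee_fin pker_ge0.
case: B => [B _ ga gb gab|_ ga gb gab|]//.
  by move=> -[->]; rewrite mulfK// gt_eqF.
by rewrite gt0_mulye// lte_fin.
Qed.

(** The Laplace transform of the kernel, by x = l s in Gamma. It is the source of the small factor
    in the weighted estimates. *)
Lemma integral_pker_exp b l : (0 < b)%R -> (0 < l)%R ->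
  \int[mu]_s (pker b s * expR (- (l * s)))%:E = (Gamma b * l `^ (- b))%:E.
Proof.
move=> b0 l0.
have : egamma b = l%:E * \int[mu]_s (pker b (l * s) * expR (- (l * s)))%:E.
  rewrite /egamma (@integral_affine _ l 0)//.
  - by under eq_integral do rewrite addr0.
  - exact: measurable_egamma_kernel.
  - by move=> x; rewrite lee_fin mulr_ge0 ?pker_ge0 ?expR_ge0.
under eq_integral do rewrite pker_scale// -mulrA EFinM.
rewrite ge0_integralZl//; last 3 first.
- exact: mE (@measurable_pkerexp _ _).
- by move=> x _; rewrite lee_fin mulr_ge0 ?pker_ge0 ?expR_ge0.
- by rewrite lee_fin powR_ge0.
rewrite muleA -EFinM mulr_powRB1 ?ltW// -EFin_Gamma// => h.
rewrite EFinM h muleAC -EFinM powRN mulfV ?mul1e//.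
by rewrite gt_eqF// powR_gt0.
Qed.

End GammaFunction.

(** * Riemann-Liouville integrals *)

Opaque Gamma.

Section FractionalIntegral.
Context {R : realType}.
Local Notation mu := (@lebesgue_measure R).
Implicit Types (f g : R -> R) (a b c l t x : R).

Lemma continuous_bounded_itv f (u v : R) : continuous f ->
  exists2 M, 0 <= M & forall x, u <= x <= v -> `|f x| <= M.
Proof.
move=> cf; have [uv|uv] := leP u v; last first.
  by exists 0 => // x /andP[/le_trans h /h]; rewrite leNgt uv.
have : {within `[u, v], continuous (fun x => `|f x|)}.
  apply: continuous_subspaceT => x.
  exact: (continuous_comp (cf x) (@norm_continuous _ _ _)).
move=> /(EVT_max uv)[c _ fc]; exists `|f c| => // x xuv.
Qed.

Lemma measurable_RL_kernel a t :
  measurable_fun [set: R] (fun x => (t - x) `^ (a - 1)).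
Proof.
apply: (measurableT_comp (@measurable_powR R (a - 1))).
exact: measurable_funB.
Qed.

(** The two sides may differ at the end points 0 and [t], a null set. *)
Lemma integral_RL a t f : measurable_fun [set: R] f ->
  (\int[mu]_(tau in `[0%R, t]) ((t - tau) `^ (a - 1) * f tau)%:E =
   convol (EFin \o pker a) (EFin \o causal f) t)%E.
Proof.
move=> mf; rewrite integral_itv_bndoo; last first.
  apply/measurable_EFinP/measurable_funTS/measurable_funM => //.
  exact: measurable_RL_kernel.
rewrite integral_mkcond; apply: eq_integral => x _ /=.
rewrite restrict_EFin /= patchE /pker !causalE subr_gt0 -EFinM.
case: ifPn => [|/negP]; rewrite inE/= in_itv/=; first by move=> /andP[-> ->].
move=> /negP/nandP[/negbTE->|/negbTE->]; first by rewrite mulr0.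
by rewrite mul0r.
Qed.

Lemma RL_intE a f t : a != 0 -> RL_int a f t = (Gamma a)^-1 *
  \int[mu]_(tau in `[0, t]) ((t - tau) `^ (a - 1) * f tau).
Proof. by move=> /negbTE a0; rewrite /RL_int a0. Qed.

Lemma RL_int0 f : RL_int 0 f = f.
Proof. by apply/funext => t; rewrite /RL_int eqxx. Qed.

Opaque RL_int.

Lemma RL_int_convol a t f : 0 < a -> measurable_fun [set: R] f ->
  RL_int a f t =
  (Gamma a)^-1 * fine (convol (EFin \o pker a) (EFin \o causal f) t).
Proof. by move=> a0 mf; rewrite RL_intE ?lt0r_neq0// /Rintegral integral_RL. Qed.

Lemma RL_int_eq a f g t : 0 <= t -> (forall x, 0 <= x <= t -> f x = g x) ->
  RL_int a f t = RL_int a g t.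
Proof.
move=> t0 fg; have [->|a0] := eqVneq a 0; first by rewrite !RL_int0 fg// t0 lexx.
rewrite !RL_intE//; congr (_ * _); apply: eq_Rintegral => x; rewrite inE/= in_itv/= => xt.
by rewrite fg.
Qed.

(** For [t < 0] the interval of integration is empty. This default makes continuity on the whole
    line, across 0, possible. *)
Lemma RL_int_le0 a f t : a != 0 -> t <= 0 -> RL_int a f t = 0.
Proof.
move=> a0; rewrite RL_intE// le_eqVlt => /predU1P[->|t0].
  by rewrite set_itv1 Rintegral_set1 mulr0.
by rewrite set_itv_ge ?bnd_simp -?ltNge// Rintegral_set0 mulr0.
Qed.

Lemma integrableZl_EFin (D : set R) c f : measurable D ->
  mu.-integrable D (EFin \o f) -> mu.-integrable D (EFin \o (fun x => c * f x)).
Proof.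
move=> mD; have -> : EFin \o (fun x => c * f x) = (fun x => c%:E * (EFin \o f) x)%E.
  by apply/funext => x; rewrite /= -EFinM.
exact: integrableZl.
Qed.

Lemma causal_cst1 : causal (cst 1) = pker 1 :> (R -> R).
Proof.
by apply/funext => x; rewrite /pker !causalE subrr powRr0.
Qed.

(** The constant 1 is itself a kernel, [pker 1] after truncation, so convergence is the finiteness
    in [convol_pkerE]. *)
Lemma integrable_RL_cst a t c : 0 < a ->
  mu.-integrable `[0, t] (EFin \o (fun x => (t - x) `^ (a - 1) * c)).
Proof.
move=> a0; have h : mu.-integrable `[0, t] (EFin \o (fun x => (t - x) `^ (a - 1))).
  have mk : measurable_fun [set: R] (EFin \o (fun x => (t - x) `^ (a - 1))).
    by apply/measurable_EFinP; exact: measurable_RL_kernel.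
  apply/integrableP; split; first exact: measurable_funTS.
  have one x : `|(t - x) `^ (a - 1)| = (t - x) `^ (a - 1) * 1.
    by rewrite mulr1 ger0_norm ?powR_ge0.
  under eq_integral do rewrite /= one.
  rewrite (@integral_RL _ _ (cst 1))//.
  by rewrite causal_cst1 convol_pkerE ?ltry.
under [X in _.-integrable _ (_ \o X)]eq_fun do rewrite mulrC.
exact: integrableZl_EFin.
Qed.

Lemma integrable_RL a t f : 0 < a -> continuous f ->
  mu.-integrable `[0, t] (EFin \o (fun x => (t - x) `^ (a - 1) * f x)).
Proof.
move=> a0 cf; have [M M0 fM] := continuous_bounded_itv 0 t cf.
apply: le_integrable (integrable_RL_cst t M a0) => //.
  apply/measurable_EFinP/measurable_funTS/measurable_funM.
    exact: measurable_RL_kernel.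
  exact: continuous_measurable_fun.
move=> x; rewrite /= in_itv/= => /fM fxM.
by rewrite !normrM lee_fin ler_wpM2l// (ger0_norm M0).
Qed.

Lemma RL_int_lin a c d f g t : 0 <= a -> continuous f -> continuous g ->
  RL_int a (fun x => c * f x + d * g x) t = c * RL_int a f t + d * RL_int a g t.
Proof.
rewrite le_eqVlt => /predU1P[<-|a0] cf cg; first by rewrite !RL_int0.
rewrite !RL_intE ?lt0r_neq0// [c * (_ * _)]mulrCA [d * (_ * _)]mulrCA -mulrDr; congr (_ * _).
rewrite -!RintegralZl//; try exact: integrable_RL.
rewrite -RintegralD//; last 2 first.
- by apply: integrableZl_EFin => //; exact: integrable_RL.
- by apply: integrableZl_EFin => //; exact: integrable_RL.
by apply: eq_Rintegral => x _; ring.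
Qed.

Lemma continuous_sum (I : Type) (r : seq I) (P : pred I) (f : I -> R -> R) :
  (forall i, P i -> continuous (f i)) ->
  continuous (fun x => \sum_(i <- r | P i) f i x).
Proof. by move=> cf; apply: continuous_big => //; exact: add_continuous. Qed.

Lemma RL_int_sum a (I : Type) (r : seq I) (P : pred I) (c : I -> R)
    (f : I -> R -> R) t : 0 <= a -> (forall i, P i -> continuous (f i)) ->
  RL_int a (fun x => \sum_(i <- r | P i) c i * f i x) t =
  \sum_(i <- r | P i) c i * RL_int a (f i) t.
Proof.
move=> a0 cf; elim: r => [|i r IH].
  under [in LHS]eq_fun do rewrite big_nil; rewrite big_nil.
  have := @RL_int_lin a 0 0 (cst 0) (cst 0) t a0 (@cst_continuous _ _ _)
    (@cst_continuous _ _ _).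
  by under [in LHS]eq_fun do rewrite /= !mul0r addr0; rewrite !mul0r addr0.
rewrite big_cons -IH; under [in LHS]eq_fun do rewrite big_cons.
case: ifP => // Pi.
rewrite -[X in _ + X]mul1r -RL_int_lin//; last 2 first.
- exact: cf.
- apply: continuous_sum => j Pj x.
  by apply: cvgM; [exact: cvg_cst|exact: (cf j Pj)].
by under [in RHS]eq_fun do rewrite mul1r.
Qed.

Lemma EFin_RL_int a t f : 0 < a -> continuous f ->
  (Gamma a * RL_int a f t)%:E =
  convol (EFin \o pker a) (EFin \o causal f) t.
Proof.
move=> a0 cf; rewrite RL_int_convol//; last exact: continuous_measurable_fun.
rewrite mulrA mulfV ?Gamma_neq0// mul1r -integral_RL ?fineK//.
  exact: integrable_fin_num (integrable_RL _ _ _).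
exact: continuous_measurable_fun.
Qed.

(** The parts are |f| and |f| - f; the coefficients 1 and -1 fit [RL_int_lin]. *)
Lemma continuous_posneg f : continuous f ->
  exists g h : R -> R, [/\ continuous g, continuous h, forall x, 0 <= g x,
    forall x, 0 <= h x & f = fun x => 1 * g x + (- 1) * h x].
Proof.
move=> cf; have cn : continuous (fun x => `|f x|).
  by move=> x; exact: (continuous_comp (cf x) (@norm_continuous _ _ _)).
exists (fun x => `|f x|), (fun x => `|f x| - f x); split => //.
- by move=> x; apply: cvgB; [exact: cn|exact: cf].
- by move=> x; rewrite subr_ge0 ler_norm.
- by apply/funext => x; ring.
Qed.

(** The substitution s = t s' moves [t] out of the singular kernel and of the domain into the
    continuous function, which prepares continuity in [t] by domination. *)
Lemma RL_int_scale a t f : 0 < a -> 0 < t -> continuous f ->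
  RL_int a f t = t `^ a * RL_int a (fun s => f (t * s)) 1.
Proof.
move=> a0 t0 cf.
wlog f0 : f cf / forall x, 0 <= f x => [H|].
  have [g [h [cg ch g0 h0 ->]]] := continuous_posneg cf.
  have ct (k : R -> R) : continuous k -> continuous (fun s => k (t * s)).
    move=> ck x; apply: continuous_comp; last exact: ck.
    by apply: cvgM; [exact: cvg_cst|exact: cvg_id].
  rewrite !RL_int_lin ?ltW//; try exact: ct.
  by rewrite (H g)// (H h)//; ring.
have cft : continuous (fun s => f (t * s)).
  move=> x; apply: continuous_comp; last exact: cf.
  by apply: cvgM; [exact: cvg_cst|exact: cvg_id].
have mf := continuous_measurable_fun cf.
have mft := continuous_measurable_fun cft.
have c0 k x : (forall x, 0 <= k x) -> 0 <= causal k x.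
  by move=> k0; rewrite causalE; case: ifP.
apply: (Gamma_mulI a0); rewrite EFin_RL_int// mulrCA EFinM EFin_RL_int// /convol.
have mk k u : measurable_fun [set: R] k ->
    measurable_fun [set: R] (fun s => (pker a (u - s) * causal k s)%:E).
  move=> mk; apply/measurable_EFinP/measurable_funM; last exact: measurable_causal.
  by apply: (measurableT_comp (@measurable_pker R a)); exact: measurable_funB.
rewrite (@integral_affine _ t 0)//; last 2 first.
- exact: mk.
- by move=> x; rewrite /= -EFinM lee_fin mulr_ge0 ?pker_ge0 ?c0.
have scale (s : R) : (pker a (t - (t * s + 0)) * causal f (t * s + 0) =
    t `^ (a - 1) * (pker a (1 - s) * causal (fun s => f (t * s)) s)).
  rewrite addr0 (_ : t - t * s = t * (1 - s)); last by ring.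
  by rewrite pker_scale// !causalE pmulr_rgt0// mulrA.
under eq_integral do rewrite /= -EFinM scale EFinM.
rewrite ge0_integralZl//; last 3 first.
- exact: mk.
- by move=> s _; rewrite lee_fin mulr_ge0 ?pker_ge0 ?c0// => x.
- by rewrite lee_fin powR_ge0.
by rewrite muleA -EFinM mulr_powRB1 ?ltW//.
Qed.

Lemma continuous_RL_int1 a f : 0 < a -> continuous f ->
  continuous (fun x => RL_int a (fun s => f (x * s)) 1).
Proof.
move=> a0 cf x0.
have cfx x : continuous (fun s => f (x * s)).
  move=> s; apply: continuous_comp; last exact: cf.
  by apply: cvgM; [exact: cvg_cst|exact: cvg_id].
(* For [x] within 1 of [x0] and [s] in [[0, 1]], the product [x * s] stays in this interval. *)
have [M M0 fM] := continuous_bounded_itv (- (`|x0| + 1)) (`|x0| + 1) cf.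
rewrite /continuous_at RL_intE ?lt0r_neq0//; under eq_fun do rewrite RL_intE ?lt0r_neq0//.
apply: cvgM; first exact: cvg_cst.
apply: (@continuity_under_integral _ _ _ mu _ `[0, 1] _ (x0 - 1) (x0 + 1) _ _
  (fun s => (1 - s) `^ (a - 1) * M)) => //.
- by move=> x _; exact: integrable_RL.
- apply: aeW => s _ x _; apply: cvgM; first exact: cvg_cst.
  apply: continuous_comp; last exact: cf.
  by apply: cvgM; [exact: cvg_id|exact: cvg_cst].
- exact: integrable_RL_cst.
- move=> x; rewrite /= in_itv/= => /andP[x1 x2]; apply: aeW => s.
  rewrite /= in_itv/= => /andP[s0 s1].
  rewrite normrM ger0_norm ?powR_ge0// ler_wpM2l ?powR_ge0// fM//.
  rewrite -ler_norml normrM -[leRHS]mulr1 ler_pM//; last by rewrite ger0_norm.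
  by rewrite ler_norml; have := ler_norm x0; have := ler_norm (- x0);
    rewrite normrN; lra.
- by rewrite inE/= in_itv/=; lra.
Qed.

Lemma near_eq_cvgl {F : set_system R} {FF : Filter F} f g l :
  (\forall x \near F, g x = f x) -> g x @[x --> F] --> l ->
  f x @[x --> F] --> l.
Proof. by move=> fg; apply: cvg_trans; exact: near_eq_cvg. Qed.

(** The function vanishes to the left of 0; to the right, scaling writes it as t^a times a
    continuous function, and t^a tends to 0 at 0. *)
Lemma continuous_RL_int a f : 0 <= a -> continuous f -> continuous (RL_int a f).
Proof.
rewrite le_eqVlt => /predU1P[<-|a0] cf; first by rewrite RL_int0.
have aN0 : a != 0 by rewrite gt_eqF.
have cH := continuous_RL_int1 a0 cf.
have J0 := @RL_int_le0 a f _ aN0.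
move=> t; rewrite /continuous_at; have [t0|t0|->] := ltgtP t 0.
- rewrite J0 ?(ltW t0)//; apply: (@near_eq_cvgl _ _ (RL_int a f) (fun=> 0)); last exact: cvg_cst.
  by near=> x; rewrite J0//; apply: ltW; near: x; exact: lt_nbhsl.
- rewrite RL_int_scale//.
  apply: (@near_eq_cvgl _ _ (RL_int a f) (fun x => x `^ a * RL_int a (fun s => f (x * s)) 1)).
    by near=> x; rewrite [RHS]RL_int_scale//; near: x; exact: lt_nbhsr.
  apply: cvgM; last exact: cH.
  suff : {for t, continuous (fun x => x `^ a)} by [].
  apply: differentiable_continuous; apply/derivable1_diffP.
  by apply: derivable_powR; rewrite in_itv/= t0.
- apply/left_right_continuousP; rewrite J0//; split.
    apply: (@near_eq_cvgl _ _ (RL_int a f) (fun=> 0)); last exact: cvg_cst.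
    by near=> x; rewrite J0.
  have h : x `^ a * RL_int a (fun s => f (x * s)) 1 @[x --> 0^'+] -->
      0 * RL_int a (fun s => f (0 * s)) 1.
    apply: cvgM; first exact: powR_cvg0.
    by apply: cvg_at_right_filter; exact: cH.
  rewrite mul0r in h; apply: near_eq_cvgl h.
  near=> x; rewrite [RHS]RL_int_scale//.
Unshelve. all: by end_near. Qed.

Local Open Scope ereal_scope.

Lemma convolZl (k : R) (u v : R -> \bar R) (t : R) : (0 <= k)%R ->
  measurable_fun [set: R] u -> measurable_fun [set: R] v ->
  (forall x, 0 <= u x) -> (forall x, 0 <= v x) ->
  convol (fun x => k%:E * u x) v t = k%:E * convol u v t.
Proof.
move=> k0 mu' mv u0 v0; rewrite /convol -ge0_integralZl//.
- by apply: eq_integral => s _; rewrite muleA.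
- apply: emeasurable_funM => //; apply: (measurableT_comp mu').
  exact: measurable_funB.
- by move=> s _; exact: mule_ge0.
Qed.

Lemma convolZr (k : R) (u v : R -> \bar R) (t : R) : (0 <= k)%R ->
  measurable_fun [set: R] u -> measurable_fun [set: R] v ->
  (forall x, 0 <= u x) -> (forall x, 0 <= v x) ->
  convol u (fun x => k%:E * v x) t = k%:E * convol u v t.
Proof.
move=> k0 mu' mv u0 v0; rewrite -convolZl//.
by apply: eq_integral => s _; rewrite muleCA muleA.
Qed.

Local Open Scope ring_scope.

Lemma RL_int_comp a b f t : 0 <= a -> 0 <= b -> continuous f ->
  RL_int a (RL_int b f) t = RL_int (a + b) f t.
Proof.
rewrite le_eqVlt => /predU1P[<-|a0]; first by rewrite RL_int0 add0r.
rewrite le_eqVlt => /predU1P[<-|b0]; first by rewrite RL_int0 addr0.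
move=> cf.
have cJ h : continuous h -> continuous (RL_int b h).
  by apply: continuous_RL_int; exact: ltW.
have ab0 : 0 < a + b by rewrite addr_gt0.
wlog f0 : f cf / forall x, 0 <= f x => [H|].
  have [g [h [cg ch g0 h0 ->]]] := continuous_posneg cf.
  rewrite [RHS]RL_int_lin ?(ltW ab0)// -!H//.
  have -> : RL_int b (fun x => 1 * g x + (-1) * h x) =
      fun x => 1 * RL_int b g x + (-1) * RL_int b h x.
    by apply/funext => x; rewrite RL_int_lin ?ltW.
  by rewrite RL_int_lin ?(ltW a0)//; [exact: cJ _ cg|exact: cJ _ ch].
have [ga gb gab] : [/\ 0 < Gamma a, 0 < Gamma b & 0 < Gamma (a + b)].
  by split; exact: Gamma_gt0.
apply: (Gamma_mulI a0); rewrite EFin_RL_int//; last exact: cJ.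
have mp c : measurable_fun [set: R] (EFin \o pker c).
  by apply/measurable_EFinP; exact: measurable_pker.
have p0 c x : (0 <= (EFin \o pker c) x)%E by rewrite lee_fin pker_ge0.
have mc : measurable_fun [set: R] (EFin \o causal f).
  apply/measurable_EFinP; apply: measurable_causal.
  exact: continuous_measurable_fun.
have c0 x : (0 <= (EFin \o causal f) x)%E.
  by rewrite lee_fin causalE; case: ifP.
have -> : EFin \o causal (RL_int b f) = (fun x => ((Gamma b)^-1)%:E *
    convol (EFin \o pker b) (EFin \o causal f) x)%E.
  apply/funext => x; rewrite -EFin_RL_int// -EFinM mulrA mulVf ?Gamma_neq0// mul1r.
  rewrite /= causalE; case: ltP => // x0.
  by rewrite RL_int_le0// lt0r_neq0.
rewrite convolZr ?invr_ge0 ?(ltW gb)//; last 2 first.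
- exact: measurable_convol.
- by move=> x; exact: convol_ge0.
rewrite convolA//.
have -> : convol (EFin \o pker a) (EFin \o pker b) =
    (fun x => (Gamma a * Gamma b / Gamma (a + b))%:E * (EFin \o pker (a + b)) x)%E.
  by apply/funext => x; rewrite convol_pkerE.
rewrite convolZl//; last by rewrite divr_ge0 ?mulr_ge0 ?(ltW ga) ?(ltW gb) ?(ltW gab).
rewrite -EFin_RL_int// -!EFinM; congr EFin.
move: (Gamma_neq0 a0) (Gamma_neq0 b0) (Gamma_neq0 ab0).
move: (Gamma a) (Gamma b) (Gamma (a + b)) (RL_int _ _ _) => A B C J A0 B0 C0.
by field; rewrite B0 C0.
Qed.

Lemma is_derive_RL_int1 f t : continuous f -> 0 < t ->
  is_derive t 1 (RL_int 1 f) (f t).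
Proof.
move=> cf t0.
have -> : RL_int 1 f = fun x => \int[mu]_(s in `[0, x]) f s.
  apply/funext => x; rewrite RL_intE ?oner_neq0// Gamma1 invr1 mul1r.
  by apply: eq_Rintegral => s _; rewrite subrr powRr0 mul1r.
have [] := @continuous_FTC1_closed R f 0 t (t + 1).
- by rewrite ltrDl.
- apply: continuous_compact_integrable; first exact: segment_compact.
  exact: continuous_subspaceT.
- exact: t0.
- exact: cf.
by move=> dF dE; split; [exact: dF|rewrite -dE derive1E].
Qed.

Lemma is_derive_RL_int a f t : 1 <= a -> continuous f -> 0 < t ->
  is_derive t 1 (RL_int a f) (RL_int (a - 1) f t).
Proof.
move=> a1 cf t0; have a0 : 0 <= a - 1 by rewrite subr_ge0.
have -> : RL_int a f = RL_int 1 (RL_int (a - 1) f).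
  by apply/funext => x; rewrite (RL_int_comp _ ler01 a0 cf) addrC subrK.
by apply: is_derive_RL_int1 => //; exact: continuous_RL_int.
Qed.

Lemma RL_int_cst1 a t : 0 <= a -> 0 <= t -> RL_int a (cst 1) t = Phi (a + 1) t.
Proof.
rewrite le_eqVlt => /predU1P[<- _|a0 t0].
  by rewrite RL_int0 add0r /Phi Gamma1 subrr powRr0 divr1.
have a10 : 0 < a + 1 by rewrite addr_gt0.
rewrite /Phi addrK; move: t0.
rewrite le_eqVlt => /predU1P[<-|t0].
  by rewrite RL_int_le0 ?powR0 ?mul0r ?lt0r_neq0.
apply: (Gamma_mulI a0); rewrite EFin_RL_int//; last exact: cst_continuous.
rewrite causal_cst1 convol_pkerE// Gamma1 mulr1 /pker causalE t0 addrK.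
by congr EFin; ring.
Qed.

(** Taking e^(l t) out leaves the kernel times e^(-l (t-s)); integrating over all [s] instead of
    [[0, t]] gives the Laplace transform of the kernel. *)
Lemma le_RL_int_exp a l t : 0 <= a -> 0 < l -> 0 <= t ->
  RL_int a (fun x => expR (l * x)) t <= l `^ (- a) * expR (l * t).
Proof.
rewrite le_eqVlt => /predU1P[<-|a0] l0 t0.
  by rewrite RL_int0 oppr0 powRr0 mul1r.
have ce : continuous (fun x => expR (l * x)).
  move=> x; apply: continuous_comp; last exact: continuous_expR.
  by apply: cvgM; [exact: cvg_cst|exact: cvg_id].
rewrite -(ler_pM2l (Gamma_gt0 a0)) -lee_fin EFin_RL_int//.
pose k (s : R) := (pker a s * expR (- (l * s))).
have mk : measurable_fun [set: R] (EFin \o k).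
  by apply/measurable_EFinP; exact: measurable_pkerexp.
have k0 s : (0 <= (EFin \o k) s)%E.
  by rewrite lee_fin mulr_ge0 ?pker_ge0 ?expR_ge0.
have mkt : measurable_fun [set: R] (fun s : R => (k (t - s))%:E).
  by apply: (measurableT_comp mk); exact: measurable_funB.
apply: (@le_trans _ _ (\int[mu]_s ((expR (l * t))%:E * (k (t - s))%:E)))%E.
  apply: ge0_le_integral => //.
  - move=> s _; rewrite mule_ge0// lee_fin ?pker_ge0// causalE.
    by case: ifP => // _; exact: expR_ge0.
  - apply/measurable_EFinP/measurable_funM.
      by apply: (measurableT_comp (@measurable_pker R a)); exact: measurable_funB.
    exact: measurable_causal (continuous_measurable_fun ce).
  - by apply: emeasurable_funM.
  - move=> s _; rewrite -!EFinM lee_fin /k mulrCA.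
    apply: ler_wpM2l; first exact: pker_ge0.
    rewrite -expRD (_ : l * t + - (l * (t - s)) = l * s); last by ring.
    by rewrite causalE; case: ifP => // _; exact: expR_ge0.
rewrite ge0_integralZl//; last first.
  by move=> s _; exact: k0.
rewrite (_ : \int[mu]_s _ = \int[mu]_s (EFin \o k) s)%E; last first.
  have mkN : measurable_fun [set: R] (fun x : R => (EFin \o k) (- x)).
    by apply: (measurableT_comp mk); exact: oppr_measurable.
  rewrite -(integral_reflect mk k0) -(integral_shift (- t) mkN (fun x => k0 (- x))).
  by apply: eq_integral => s _; rewrite /= opprB addrC.
rewrite integral_pker_exp// -EFinM lee_fin le_eqVlt; apply/orP; left.
by apply/eqP; ring.
Qed.

Lemma RL_int_le_exp a l K t f : 0 <= a -> 0 < l -> 0 <= t -> continuous f ->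
  (forall x, 0 <= x <= t -> `|f x| <= K * expR (l * x)) ->
  `|RL_int a f t| <= K * (l `^ (- a) * expR (l * t)).
Proof.
move=> a0 l0 t0 cf fK.
have K0 : 0 <= K.
  have := fK 0; rewrite lexx t0 mulr0 expR0 mulr1 => /(_ isT).
  exact: le_trans.
apply: le_trans (ler_wpM2l K0 (le_RL_int_exp a0 l0 t0)).
move: a0; rewrite le_eqVlt => /predU1P[<-|a0].
  by rewrite !RL_int0 fK// t0 lexx.
have ce : continuous (fun x => expR (l * x)).
  move=> x; apply: continuous_comp; last exact: continuous_expR.
  by apply: cvgM; [exact: cvg_cst|exact: cvg_id].
have gi : 0 <= (Gamma a)^-1 by rewrite invr_ge0 ltW// Gamma_gt0.
rewrite !RL_intE ?lt0r_neq0// normrM mulrCA (ger0_norm gi).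
apply: (ler_wpM2l gi).
apply: le_trans (le_normr_Rintegral _ _) _ => //; first exact: integrable_RL.
rewrite -RintegralZl//; last exact: integrable_RL.
apply: le_Rintegral => //.
- have := integrable_norm (integrable_RL t a0 cf).
  by rewrite /comp.
- by apply: integrableZl_EFin => //; exact: integrable_RL.
- move=> x; rewrite /= in_itv/= => xt.
  by rewrite normrM ger0_norm ?powR_ge0// mulrCA ler_wpM2l ?powR_ge0// fK.
Qed.

End FractionalIntegral.

(** * Derivatives of Riemann-Liouville integrals *)

Section Derivatives.
Context {R : realType}.
Implicit Types (f g u v : R -> R) (b : nat -> R) (T a c s t x : R) (k n : nat).

Lemma near_itv0 T t : 0 < t < T -> \forall x \near t, 0 < x < T.
Proof.
move=> tT; have tT' : t \in `]0, T[%R by rewrite in_itv.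
by apply: filterS (near_in_itvoo tT') => x; rewrite in_itv.
Qed.

Lemma near_right_itv0 T : 0 < T -> \forall x \near 0^'+, 0 < x < T.
Proof.
move=> T0; near=> x; apply/andP; split; first by near: x; exact: nbhs_right_gt.
by near: x; exact: nbhs_right_lt.
Unshelve. all: by end_near. Qed.

Lemma is_derive_bigsum (I : Type) (r : seq I) (P : pred I) (h : I -> R -> R)
    (dh : I -> R) t : (forall i, P i -> is_derive t 1 (h i) (dh i)) ->
  is_derive t 1 (fun x => \sum_(i <- r | P i) h i x) (\sum_(i <- r | P i) dh i).
Proof.
move=> dhP; elim: r => [|i r IH].
  rewrite big_nil; under eq_fun do rewrite big_nil.
  exact: is_derive_cst.
rewrite big_cons; under eq_fun do rewrite big_cons.
case: ifP => // Pi; have := @is_deriveD _ _ _ _ _ _ _ _ _ (dhP _ Pi) IH.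
by [].
Qed.

Lemma is_deriveZ_fun (c : R) f t d : is_derive t 1 f d ->
  is_derive t 1 (fun x => c * f x) (c * d).
Proof. by move=> df; have := @is_deriveZ _ _ _ _ c _ _ _ df. Qed.

(** [G] lists the candidate derivatives. Derivatives are local, so each identity on the open
    interval can be differentiated there. *)
Lemma derive1n_chain T f (G : nat -> R -> R) n :
  (forall t, 0 < t < T -> f t = G 0%N t) ->
  (forall k, (k < n)%N -> forall t, 0 < t < T ->
     is_derive t 1 (G k) (G k.+1 t)) ->
  forall k, (k <= n)%N -> forall t, 0 < t < T -> f^`(k) t = G k t.
Proof.
move=> f0 dG; elim=> [|k IH] kn t tT; first exact: f0.
have fk : \forall x \near t, G k x = f^`(k) x.
  by apply: filterS (near_itv0 tT) => x xT; rewrite IH// ltnW.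
rewrite /= derive1E -(near_eq_derive _ fk).
exact: (@derive_val _ _ _ _ _ _ _ (dG k kn t tT)).
Qed.

Lemma n_derivable_chain T f (G : nat -> R -> R) n :
  (forall t, 0 < t < T -> f t = G 0%N t) ->
  (forall k, (k < n)%N -> forall t, 0 < t < T ->
     is_derive t 1 (G k) (G k.+1 t)) ->
  n_derivable T n f.
Proof.
move=> f0 dG k kn t tT.
apply: (near_eq_derivable _ (@ex_derive _ _ _ _ _ _ _ (dG k kn t tT))).
by apply: filterS (near_itv0 tT) => x xT;
  rewrite (derive1n_chain f0 dG (ltnW kn)).
Qed.

Lemma RL_int_at0 a f : a != 0 -> RL_int a f 0 = 0.
Proof. by move=> a0; rewrite RL_int_le0. Qed.

Lemma RL_int_right0 a f : 0 < a -> continuous f ->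
  RL_int a f x @[x --> 0^'+] --> 0.
Proof.
move=> a0 cf; rewrite -[X in _ --> X](RL_int_at0 f (lt0r_neq0 a0)).
by apply: cvg_at_right_filter; exact: (continuous_RL_int (ltW a0) cf).
Qed.

(** The difference has zero derivative, hence is constant by the mean value theorem, and it tends to
    0 at +0. *)
Lemma antiderivative_RL_int1 T f v : 0 < T -> continuous v ->
  (forall t, 0 < t < T -> is_derive t 1 f (v t)) ->
  f x @[x --> 0^'+] --> 0 ->
  forall t, 0 < t < T -> f t = RL_int 1 v t.
Proof.
move=> T0 cv df f0.
pose d x := f x - RL_int 1 v x.
have dd t : 0 < t < T -> is_derive t 1 d 0.
  move=> tT; have t0 : 0 < t by case/andP: tT.
  rewrite -(subrr (v t)).
  by apply: is_deriveB; [exact: df|exact: is_derive_RL_int1].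
have dcst s t : 0 < s -> s < t -> t < T -> d s = d t.
  move=> s0 st tT.
  have sub x : s <= x <= t -> 0 < x < T.
    by move=> /andP[sx xt]; rewrite (lt_le_trans s0 sx) (le_lt_trans xt tT).
  have [||c _] := @MVT R d (fun=> 0) s t st.
  - move=> x; rewrite in_itv/= => /andP[sx xt].
    by apply: dd; apply: sub; rewrite !ltW.
  - apply: continuous_in_subspaceT => x; rewrite inE/= in_itv/= => /sub xT.
    apply: differentiable_continuous; apply/derivable1_diffP.
    exact: (@ex_derive _ _ _ _ _ _ _ (dd _ xT)).
  by rewrite mul0r => /eqP; rewrite subr_eq0 => /eqP ->.
have d0 : d x @[x --> 0^'+] --> 0.
  have : d x @[x --> 0^'+] --> 0 - 0.
    by apply: cvgB => //; exact: RL_int_right0.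
  by rewrite subr0.
move=> t tT; apply/eqP; rewrite -subr_eq0 -/(d t); apply/eqP.
have dt : d x @[x --> 0^'+] --> d t.
  apply: (@near_eq_cvgl _ _ _ d (fun=> d t)); last exact: cvg_cst.
  case/andP: tT => t0 tT.
  by apply: filterS (near_right_itv0 t0) => x /andP[x0 xt]; rewrite (dcst x t).
exact: (cvg_unique (@Rhausdorff R) dt d0).
Qed.

(** Taylor's formula with integral remainder for vanishing initial values: the highest derivative is
    integrated [k] times. *)
Lemma Taylor_RL_int T k f v : 0 < T -> continuous v ->
  n_derivable T k f ->
  (forall i, (i < k)%N -> f^`(i) x @[x --> 0^'+] --> 0) ->
  (forall t, 0 < t < T -> f^`(k) t = v t) ->
  forall t, 0 < t < T -> f t = RL_int k%:R v t.
Proof.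
move=> T0; elim: k v => [|k IH] v cv df f0 fv t tT.
  by rewrite RL_int0 -fv.
have cJ : continuous (RL_int 1 v) by exact: continuous_RL_int.
rewrite (IH (RL_int 1 v)) //.
- by rewrite (RL_int_comp _ (ler0n _ k) ler01 cv) natr1.
- by move=> i ik; apply: df; exact: ltnW.
- by move=> i ik; apply: f0; exact: ltnW.
apply: antiderivative_RL_int1 => //; last exact: f0.
move=> x xT; rewrite -(fv _ xT) /= derive1E.
by apply: DeriveDef => //; exact: df.
Qed.

(** By induction through antiderivatives, so that factorials never have to be matched with values of
    Gamma. *)
Lemma RL_int_nat_cst1 k t : 0 <= t -> RL_int k%:R (cst 1) t = t ^+ k / k`!%:R.
Proof.
elim: k t => [|k IH] t; first by rewrite RL_int0 expr0 divr1.
rewrite le_eqVlt => /predU1P[<-|t0].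
  by rewrite RL_int_at0 ?pnatr_eq0// expr0n mul0r.
have c1 : continuous (cst 1 : R -> R) by exact: cst_continuous.
rewrite -natr1 addrC -(RL_int_comp _ ler01 (ler0n _ k))//.
(* The right end [t + 1] places [t] inside the open interval. *)
apply/esym; apply: (@antiderivative_RL_int1 (t + 1) (fun t => t ^+ k.+1 / k.+1`!%:R)).
- by rewrite addr_gt0.
- exact: continuous_RL_int.
- move=> x /andP[x0 _]; rewrite IH ?ltW//.
  have dX : is_derive x 1 (fun t : R => t ^+ k.+1) (k.+1%:R * x ^+ k).
    apply: DeriveDef; first exact: exprn_derivable.
    by rewrite exp_derive /GRing.scale /= mulr1.
  have := is_deriveZ_fun (k.+1`!%:R^-1) dX.
  under eq_fun do rewrite mulrC.
  rewrite (_ : _ * _ = x ^+ k / k`!%:R)//.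
  rewrite factS natrM; field; by rewrite nat1r !pnatr_eq0 -lt0n fact_gt0.
- have : t ^+ k.+1 / k.+1`!%:R @[t --> 0^'+] --> (0 : R) ^+ k.+1 / k.+1`!%:R.
    apply: cvg_at_right_filter; apply: cvgM; last exact: cvg_cst.
    exact: exprn_continuous.
  by rewrite expr0n mul0r.
- by rewrite t0 ltrDl ltr01.
Qed.

(** The derivative of order [s] of [sum_(l < n) b l * I^l 1 + I^a u], without the
    terms of index [l < k], which a Caputo derivative of order [s] in ]k - 1, k]
    annihilates. *)
Definition fracsum (n k : nat) (b : nat -> R) (s a : R) (u : R -> R) (t : R) : R :=
  \sum_(k <= l < n) b l * RL_int (l%:R - s) (cst 1) t + RL_int (a - s) u t.

(** Repeating the range as a predicate hands [k <= l], hence a nonnegative order [l%:R - s], to the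
    lemmas on sums. *)
Lemma fracsumE n k b s a u : fracsum n k b s a u = fun t =>
  \sum_(k <= l < n | (k <= l < n)%N) b l * RL_int (l%:R - s) (cst 1) t +
  RL_int (a - s) u t.
Proof. by apply/funext => t; rewrite /fracsum big_nat. Qed.

Lemma continuous_fracsum n k b s a u : s <= k%:R -> s <= a -> continuous u ->
  continuous (fracsum n k b s a u).
Proof.
move=> sk sa cu x; rewrite fracsumE; apply: cvgD; last first.
  by apply: (continuous_RL_int _ cu); rewrite subr_ge0.
suff : continuous (fun t : R => \sum_(k <= l < n | (k <= l < n)%N)
    b l * RL_int (l%:R - s) (cst 1) t) by apply.
apply: continuous_sum => l /andP[kl _] z.
apply: cvgM; first exact: cvg_cst.
apply: continuous_RL_int; last exact: cst_continuous.
by rewrite subr_ge0 (le_trans sk)// ler_nat.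
Qed.

Lemma is_derive_fracsum n k b s a u t : s + 1 <= k%:R -> s + 1 <= a ->
  continuous u -> 0 < t ->
  is_derive t 1 (fracsum n k b s a u) (fracsum n k b (s + 1) a u t).
Proof.
move=> sk sa cu t0; rewrite !fracsumE.
apply: is_deriveD; last first.
  by rewrite opprD addrA; apply: is_derive_RL_int => //; rewrite lerBrDl.
apply: is_derive_bigsum => l /andP[kl _].
apply: is_deriveZ_fun; rewrite opprD addrA.
apply: is_derive_RL_int => //; last exact: cst_continuous.
by rewrite lerBrDl (le_trans sk)// ler_nat.
Qed.

Lemma fracsum_recl n k b a u : (k < n)%N ->
  fracsum n k b k%:R a u = fun t => b k + fracsum n k.+1 b k%:R a u t.
Proof.
move=> kn; apply/funext => t; rewrite /fracsum big_ltn// subrr RL_int0 mulr1.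
by rewrite addrA.
Qed.

(** At the integer order [k] the term of index [k] is the constant [b k]; differentiation removes
    it, hence the shift of the lower index. *)
Lemma is_derive_fracsumS n k b a u t : (k < n)%N -> k.+1%:R <= a ->
  continuous u -> 0 < t ->
  is_derive t 1 (fracsum n k b k%:R a u) (fracsum n k.+1 b k.+1%:R a u t).
Proof.
move=> kn ka cu t0; rewrite fracsum_recl//.
have df : is_derive t 1 (fracsum n k.+1 b k%:R a u) (fracsum n k.+1 b k.+1%:R a u t).
  by rewrite -[k.+1%:R]natr1; apply: is_derive_fracsum => //; rewrite natr1.
have := @is_deriveD _ _ _ _ _ _ _ _ _ (is_derive_cst (b k) t 1) df.
by rewrite add0r.
Qed.

Lemma RL_int_fracsum c n k b s a u t : 0 <= c -> s <= k%:R -> s <= a ->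
  continuous u ->
  RL_int c (fracsum n k b s a u) t = fracsum n k b (s - c) a u t.
Proof.
move=> c0 sk sa cu; have sa0 : 0 <= a - s by rewrite subr_ge0.
have cl l : (k <= l < n)%N -> continuous (RL_int (l%:R - s) (cst 1)).
  move=> /andP[kl _]; apply: continuous_RL_int; last exact: cst_continuous.
  by rewrite subr_ge0 (le_trans sk)// ler_nat.
have -> : fracsum n k b s a u = fun t => 1 * (\sum_(k <= l < n | (k <= l < n)%N)
    b l * RL_int (l%:R - s) (cst 1) t) + 1 * RL_int (a - s) u t.
  by rewrite fracsumE; apply/funext => x; rewrite !mul1r.
rewrite RL_int_lin//; last 2 first.
- apply: continuous_sum => l /cl clc x.
  by apply: cvgM; [exact: cvg_cst|exact: clc].
- exact: continuous_RL_int.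
rewrite !mul1r (RL_int_comp _ c0 sa0 cu) fracsumE (RL_int_sum _ _ _ c0 cl).
congr (_ + _).
  apply: eq_bigr => l /andP[kl _]; congr (_ * _).
  have ls : 0 <= l%:R - s by rewrite subr_ge0 (le_trans sk)// ler_nat.
  rewrite (RL_int_comp _ c0 ls (@cst_continuous _ _ _)).
  by congr (RL_int _ _ _); ring.
by congr (RL_int _ _ _); ring.
Qed.

Lemma fracsum_at0 n k b s a u : s < k%:R -> s < a -> fracsum n k b s a u 0 = 0.
Proof.
move=> sk sa; rewrite /fracsum RL_int_at0 ?lt0r_neq0 ?subr_gt0// addr0.
rewrite big_nat big1// => l /andP[kl _]; rewrite RL_int_at0 ?mulr0//.
by rewrite lt0r_neq0// subr_gt0 (lt_le_trans sk)// ler_nat.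
Qed.

Lemma fracsum_at0_diag n k b a u : (k < n)%N -> k%:R < a ->
  fracsum n k b k%:R a u 0 = b k.
Proof.
by move=> kn ka; rewrite fracsum_recl// fracsum_at0 ?addr0// ltr_nat.
Qed.

End Derivatives.

(** * Functions with a continuous Caputo derivative *)

Section ClosedInterval.
Context {R : realType}.
Implicit Types (f g u v : R -> R) (b : nat -> R) (T a c s t x : R) (k n : nat).

Lemma within_cont_eq T f g : continuous g ->
  (forall t, 0 <= t <= T -> f t = g t) -> {within `[0, T], continuous f}.
Proof.
move=> cg fg; apply: (@subspace_eq_continuous _ _ _ (g : subspace `[0, T] -> R)).
  by move=> x; rewrite inE/= in_itv/= => /fg.
exact: continuous_subspaceT.
Qed.

Lemma eq_closed_itv T f g : 0 < T ->
  {within `[0, T], continuous f} -> {within `[0, T], continuous g} ->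
  (forall t, 0 < t < T -> f t = g t) -> forall t, 0 <= t <= T -> f t = g t.
Proof.
move=> T0 /(continuous_within_itvP _ T0)[_ f0 fT].
move=> /(continuous_within_itvP _ T0)[_ g0 gT] fg t /andP[].
rewrite le_eqVlt => /predU1P[<- _|t0].
  apply: (cvg_unique (@Rhausdorff R) f0); apply: near_eq_cvgl g0.
  by apply: filterS (near_right_itv0 T0) => x /fg.
rewrite le_eqVlt => /predU1P[->|tT]; last by apply: fg; rewrite t0.
apply: (cvg_unique (@Rhausdorff R) fT); apply: near_eq_cvgl gT.
near=> x; apply/esym/fg/andP; split.
  by near: x; exact: nbhs_left_gt.
by near: x; exact: nbhs_left_lt.
Unshelve. all: by end_near. Qed.

(** Turns continuity on [[0, T]] into continuity on the whole line, the form in which [RL_int] is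
    studied. *)
Definition const_ext T f x := if x < 0 then f 0 else if T < x then f T else f x.

Lemma const_extE T f t : 0 <= t <= T -> const_ext T f t = f t.
Proof. by move=> /andP[t0 tT]; rewrite /const_ext ltNge t0/= ltNge tT. Qed.

Lemma continuous_const_ext T f : 0 < T -> {within `[0, T], continuous f} ->
  continuous (const_ext T f).
Proof.
move=> T0 /(continuous_within_itvP _ T0)[cf f0 fT].
have E0 : const_ext T f 0 = f 0 by rewrite const_extE// lexx ltW.
have ET : const_ext T f T = f T by rewrite const_extE// lexx ltW.
have in0T x : 0 < x < T -> f x = const_ext T f x.
  by move=> /andP[? ?]; rewrite const_extE// !ltW.
move=> x; rewrite /continuous_at; have [x0|x0|->] := ltgtP x 0.
- rewrite {2}/const_ext x0.
  apply: (@near_eq_cvgl _ _ _ (const_ext T f) (fun=> f 0)); last exact: cvg_cst.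
  by apply: filterS (lt_nbhsl x0) => z z0; rewrite /const_ext z0.
- have [xT|xT|->] := ltgtP x T.
  + have xx : 0 < x < T by rewrite x0.
    rewrite -in0T//; apply: (@near_eq_cvgl _ _ _ (const_ext T f) f).
      by apply: filterS (near_itv0 xx) => z /in0T.
    by apply: cf; rewrite in_itv.
  + rewrite {2}/const_ext ltNge (ltW x0)/= xT.
    apply: (@near_eq_cvgl _ _ _ (const_ext T f) (fun=> f T)); last exact: cvg_cst.
    apply: filterS (lt_nbhsr xT) => z zT.
    by rewrite /const_ext ltNge (ltW (lt_trans T0 zT))/= zT.
  + apply/left_right_continuousP; rewrite ET; split.
      apply: near_eq_cvgl fT; near=> z; apply: in0T; apply/andP; split.
        by near: z; exact: nbhs_left_gt.
      by near: z; exact: nbhs_left_lt.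
    apply: (@near_eq_cvgl _ _ _ (const_ext T f) (fun=> f T)); last exact: cvg_cst.
    near=> z; have zT : T < z by near: z; exact: nbhs_right_gt.
    by rewrite /const_ext ltNge (ltW (lt_trans T0 zT))/= zT.
- apply/left_right_continuousP; rewrite E0; split; last first.
    apply: near_eq_cvgl f0.
    by apply: filterS (near_right_itv0 T0) => z /in0T.
  apply: (@near_eq_cvgl _ _ _ (const_ext T f) (fun=> f 0)); last exact: cvg_cst.
  near=> z; have z0 : z < 0 by near: z; exact: nbhs_left_lt.
  by rewrite /const_ext z0.
Unshelve. all: by end_near. Qed.

Lemma frac_ordE a n : n%:R - 1 < a <= n%:R -> frac_ord a = n.
Proof.
move=> an; rewrite /frac_ord (_ : Num.ceil a = n%:Z) ?absz_nat//.
by apply/eqP; rewrite ceil_eq rmorphB /=.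
Qed.

End ClosedInterval.

(** * From the integral representation to regularity and Caputo derivatives *)

Section Representation.
Context {R : realType}.
Variables (T a : R) (n : nat) (b : nat -> R) (u y : R -> R).
Hypotheses (T0 : 0 < T) (n0 : (0 < n)%N) (an : n%:R - 1 < a) (cu : continuous u).
Hypothesis yE : forall t, 0 <= t <= T -> y t = fracsum n 0 b 0 a u t.

Let lt_nat k : (k < n)%N -> k%:R < a.
Proof.
move=> kn; apply: le_lt_trans an; rewrite lerBrDr natr1.
by rewrite ler_nat.
Qed.

Lemma rep_derive1n k : (k < n)%N -> forall t, 0 < t < T ->
  y^`(k) t = fracsum n k b k%:R a u t.
Proof.
move=> kn; apply: (@derive1n_chain _ T y (fun k => fracsum n k b k%:R a u) n.-1).
- by move=> t /andP[? ?]; rewrite yE// !ltW.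
- move=> l ln t /andP[t0 _]; apply: is_derive_fracsumS => //.
    by rewrite (leq_trans ln)// leq_pred.
  by apply: ltW; apply: lt_nat; rewrite -(prednK n0) ltnS.
- by rewrite -ltnS prednK.
Qed.

Lemma rep_right0 k : (k < n)%N -> y^`(k) x @[x --> 0^'+] --> b k.
Proof.
move=> kn; rewrite -[X in _ --> X](fracsum_at0_diag b u kn (lt_nat kn)).
apply: (@near_eq_cvgl _ _ _ _ (fracsum n k b k%:R a u)).
  by apply: filterS (near_right_itv0 T0) => x xT; rewrite rep_derive1n.
apply: cvg_at_right_filter.
by apply: (continuous_fracsum _ _ cu) => //; exact: ltW (lt_nat kn).
Qed.

Lemma rep_der_at0 k : (k < n)%N -> der_at0 y k = b k.
Proof. by move=> kn; apply: cvg_lim => //; exact: rep_right0. Qed.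

Lemma rep_C_n : C_n T n.-1 y.
Proof.
have cF k : (k < n)%N -> continuous (fracsum n k b k%:R a u).
  by move=> kn; apply: continuous_fracsum => //; exact: ltW (lt_nat kn).
split.
- apply: within_cont_eq yE; exact: (cF 0%N).
- apply: (@n_derivable_chain _ T y (fun k => fracsum n k b k%:R a u) n.-1).
  + by move=> t /andP[? ?]; rewrite yE// !ltW.
  + move=> l ln t /andP[t0 _]; apply: is_derive_fracsumS => //.
      by rewrite (leq_trans ln)// leq_pred.
    by apply: ltW; apply: lt_nat; rewrite -(prednK n0) ltnS.
- move=> k kn; have {}kn : (k < n)%N by rewrite -(prednK n0) ltnS.
  exists (fracsum n k b k%:R a u); split; last exact: rep_derive1n.
  exact: continuous_subspaceT (cF k kn).
Qed.

(** The initial derivatives of [y] are the [b k], and I^k 1 is t^k / k!, so the Taylor polynomial is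
    exactly the part of index below [N]. *)
Lemma rep_sub_Taylor0 N : (N <= n)%N -> forall t, 0 <= t <= T ->
  sub_Taylor0 N y t = fracsum n N b 0 a u t.
Proof.
move=> Nn t tT; rewrite /sub_Taylor0 yE// /fracsum (big_cat_nat (n := N))//=.
rewrite (_ : \sum_(0 <= k < N) der_at0 y k / k`!%:R * t ^+ k =
  \sum_(0 <= l < N) b l * RL_int (l%:R - 0) (cst 1) t); first by ring.
rewrite !big_nat; apply: eq_bigr => k /andP[_ kN].
rewrite rep_der_at0 ?(leq_trans kN)// subr0 RL_int_nat_cst1; last by case/andP: tT.
by ring.
Qed.

Lemma rep_Caputo alpha N : N%:R - 1 < alpha <= N%:R -> (N <= n)%N ->
    alpha <= a ->
  n_derivable T (frac_ord alpha)
    (RL_int ((frac_ord alpha)%:R - alpha) (sub_Taylor0 (frac_ord alpha) y)) /\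
  forall t, 0 < t < T -> Caputo alpha y t = fracsum n N b alpha a u t.
Proof.
move=> aN Nn aa; rewrite /Caputo /RL_der (frac_ordE aN).
case/andP: aN => _ aN.
(* The integral lowers the order from 0 to [alpha - N], and each of the [N] derivatives raises it by
   1. It never exceeds [alpha], hence neither [N] nor [a], so every derivative is licit. *)
pose G k := fracsum n N b (alpha - N%:R + k%:R) a u.
have a0 : 0 <= a by apply/ltW; apply: (lt_nat n0).
have f0 t : 0 < t < T ->
    RL_int (N%:R - alpha) (sub_Taylor0 N y) t = G 0%N t.
  move=> /andP[t0 tT]; rewrite (@RL_int_eq _ _ _ (fracsum n N b 0 a u)) ?ltW//.
    have Na : 0 <= N%:R - alpha by rewrite subr_ge0.
    rewrite (RL_int_fracsum _ _ _ Na (ler0n _ N) a0 cu).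
    by rewrite /G; congr (fracsum _ _ _ _ _ _ _); ring.
  move=> x /andP[x0 xt]; apply: rep_sub_Taylor0 => //.
  by rewrite x0 (le_trans xt)// ltW.
have dG k : (k < N)%N -> forall t, 0 < t < T -> is_derive t 1 (G k) (G k.+1 t).
  move=> kN t /andP[t0 _].
  rewrite /G -[k.+1%:R]natr1 addrA; apply: is_derive_fracsum => //.
    have : k%:R + 1 <= N%:R :> R by rewrite natr1 ler_nat.
    by lra.
  have : k%:R + 1 <= N%:R :> R by rewrite natr1 ler_nat.
  by lra.
split; first exact: (n_derivable_chain f0 dG).
move=> t tT; rewrite (derive1n_chain f0 dG (leqnn N) tT) /G.
by congr (fracsum _ _ _ _ _ _ _); ring.
Qed.

End Representation.

(** * From a continuous Caputo derivative back to the integral representation *)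

Section Converse.
Context {R : realType}.

Lemma RL_int_cst0 (c t : R) : 0 <= c -> RL_int c (cst 0) t = 0.
Proof.
move=> c0; have := @RL_int_lin R c 0 0 (cst 0) (cst 0) t c0
  (@cst_continuous _ _ _) (@cst_continuous _ _ _).
by under [in LHS]eq_fun do rewrite /= !mul0r addr0; rewrite !mul0r addr0.
Qed.

Variables (T a : R) (n : nat) (b : nat -> R) (u z : R -> R).
Hypotheses (T0 : 0 < T) (n0 : (0 < n)%N) (an : n%:R - 1 < a <= n%:R).
Hypotheses (cu : continuous u) (zC : C_Caputo T a n.-1 z).
Hypotheses (zb : init_cond n b z).
Hypothesis zu : forall t, 0 < t < T -> Caputo a z t = u t.

Let a0 : 0 <= a.
Proof.
have : 0 <= n%:R - 1 :> R by rewrite subr_ge0 ler1n.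
by case/andP: an => an1 _ /le_trans; apply; exact: ltW.
Qed.

Let n1E : (n.-1)%:R + 1 = n%:R :> R.
Proof. by rewrite natr1 prednK. Qed.

(** With zero density this is the Taylor polynomial of the initial values; subtracting it from [z]
    leaves [w], whose initial derivatives vanish. *)
Let y0 := fracsum n 0 b 0 a (cst 0).

Let an1 : n%:R - 1 < a. Proof. by case/andP: an. Qed.

Let c0 : continuous (cst 0 : R -> R). Proof. exact: cst_continuous. Qed.

Let w t := z t - y0 t.

Let y0E : forall t, 0 <= t <= T -> y0 t = fracsum n 0 b 0 a (cst 0) t.
Proof. by []. Qed.

Let w_derive : forall k, (k <= n.-1)%N -> forall t, 0 < t < T ->
  w^`(k) t = derive1n k z t - derive1n k y0 t.
Proof.
have [[_ dz _] _ _] := zC.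
have [_ dy _] := rep_C_n n0 an1 c0 y0E.
apply: (@derive1n_chain _ T w (fun k t => derive1n k z t - derive1n k y0 t)) => //.
move=> k kn t tT; apply: is_deriveB.
  by apply: DeriveDef; [exact: dz|rewrite /= derive1E].
by apply: DeriveDef; [exact: dy|rewrite /= derive1E].
Qed.

Let w_derivable : n_derivable T n.-1 w.
Proof.
have [[_ dz _] _ _] := zC.
have [_ dy _] := rep_C_n n0 an1 c0 y0E.
apply: (@n_derivable_chain _ T w (fun k t => derive1n k z t - derive1n k y0 t)) => //.
move=> k kn t tT; apply: is_deriveB.
  by apply: DeriveDef; [exact: dz|rewrite /= derive1E].
by apply: DeriveDef; [exact: dy|rewrite /= derive1E].
Qed.

Let w_right0 k : (k < n)%N -> w^`(k) x @[x --> 0^'+] --> 0.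
Proof.
move=> kn; have : derive1n k z x - derive1n k y0 x @[x --> 0^'+] --> b k - b k.
  by apply: cvgB; [exact: zb|exact: (rep_right0 T0 n0 an1 c0 y0E)].
rewrite subrr; apply: near_eq_cvgl.
apply: filterS (near_right_itv0 T0) => x xT; rewrite w_derive//.
by rewrite -ltnS prednK.
Qed.

Let sub_Taylor0_w t : 0 <= t <= T -> sub_Taylor0 n z t = w t.
Proof.
move=> tT; have := rep_sub_Taylor0 T0 n0 an1 c0 y0E (leqnn n) tT.
rewrite /fracsum big_geq// add0r RL_int_cst0 ?subr0// /sub_Taylor0 => sy.
rewrite (_ : \sum_(0 <= k < n) der_at0 z k / k`!%:R * t ^+ k =
             \sum_(0 <= k < n) der_at0 y0 k / k`!%:R * t ^+ k).
  by move/eqP: sy; rewrite subr_eq0 => /eqP <-.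
rewrite !big_nat; apply: eq_bigr => k /andP[_ kn].
rewrite (rep_der_at0 T0 n0 an1 c0 y0E kn).
by rewrite (_ : der_at0 z k = b k)//; apply: cvg_lim => //; exact: zb.
Qed.

(** [v] extends the last derivative of [w] that is known to exist, the one of order [n.-1]. *)
Let v_exists : exists v : R -> R, [/\ continuous v, v 0 = 0 &
  forall t, 0 < t < T -> w^`(n.-1) t = v t].
Proof.
have nn : (n.-1 < n)%N by rewrite prednK.
have [[_ _ /(_ _ (leqnn _))[Z [cZ zZ]]] _ _] := zC.
pose v t := const_ext T Z t - fracsum n n.-1 b n.-1%:R a (cst 0) t.
have cv : continuous v.
  move=> t; apply: cvgB; first exact: continuous_const_ext.
  by apply: continuous_fracsum => //; rewrite -[_%:R](addrK 1) n1E ltW.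
have wv t : 0 < t < T -> w^`(n.-1) t = v t.
  move=> tT; rewrite w_derive// zZ// (rep_derive1n n0 an1 c0 y0E)//.
  by rewrite /v const_extE//; case/andP: tT => ? ?; rewrite !ltW.
exists v; split => //.
have v0 : v x @[x --> 0^'+] --> v 0 by apply: cvg_at_right_filter; exact: cv.
apply: (cvg_unique (@Rhausdorff R) v0).
apply: near_eq_cvgl (w_right0 nn).
by apply: filterS (near_right_itv0 T0) => x xT; rewrite wv.
Qed.

(** Here w = I^(n-1) v, so differentiating I^(n-a) w only [n.-1] times gives I^(n-a) v, whose
    derivative is the Caputo derivative [u]. Hence I^(n-a) v = I^1 u. Applying I^a gives I^n v =
    I^(a+1) u, that is I^1 w = I^1 (I^a u), and one differentiation yields w = I^a u. *)
Lemma Caputo_rep t : 0 <= t <= T -> z t = fracsum n 0 b 0 a u t.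
Proof.
have [v [cv v0 wv]] := v_exists.
have [[cz _ _] dC _] := zC.
have cJ c f : 0 <= c -> continuous f -> {within `[0, T], continuous (RL_int c f)}.
  by move=> ? ?; apply: continuous_subspaceT; exact: continuous_RL_int.
have cy0 : continuous y0 by exact: continuous_fracsum.
have n10 : 0 <= n.-1%:R :> R by [].
have na0 : 0 <= n%:R - a by case/andP: an => _; rewrite subr_ge0.
have wJ s : 0 <= s <= T -> w s = RL_int n.-1%:R v s.
  apply: eq_closed_itv => //.
  - by apply: within_continuousB => //; exact: continuous_subspaceT.
  - exact: cJ.
  - apply: Taylor_RL_int => // i i1; apply: w_right0.
    by rewrite (leq_trans i1)// leq_pred.
pose g := RL_int (n%:R - a) (sub_Taylor0 n z).
have gE s : 0 < s < T -> g s = RL_int (n%:R - a + n.-1%:R) v s.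
  move=> /andP[s0 sT]; rewrite /g (@RL_int_eq _ _ _ (RL_int n.-1%:R v)) ?(ltW s0)//.
    by rewrite (RL_int_comp _ na0 n10 cv).
  move=> x /andP[x0 xs]; have xT : 0 <= x <= T by rewrite x0 (le_trans xs (ltW sT)).
  by rewrite sub_Taylor0_w// wJ.
pose G k := RL_int (n%:R - a + n.-1%:R - k%:R) v.
have g0 s : 0 < s < T -> g s = G 0%N s by move=> sT; rewrite (gE _ sT) /G subr0.
have dG k : (k < n.-1)%N -> forall s, 0 < s < T -> is_derive s 1 (G k) (G k.+1 s).
  move=> kn s /andP[s0 _]; rewrite /G -[k.+1%:R]natr1 opprD addrA.
  apply: is_derive_RL_int => //.
  have : k%:R + 1 <= n.-1%:R :> R by rewrite natr1 ler_nat.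
  by lra.
have g1 s : 0 < s < T -> g^`(n.-1) s = RL_int (n%:R - a) v s.
  by move=> sT; rewrite (derive1n_chain g0 dG (leqnn _) sT) /G addrK.
have Jv s : 0 <= s <= T -> RL_int (n%:R - a) v s = RL_int 1 u s.
  apply: eq_closed_itv => //; [exact: cJ|exact: cJ|].
  apply: (antiderivative_RL_int1 T0 cu).
    move=> x xT; apply: (@near_eq_is_derive _ _ _ (g^`(n.-1))).
      by apply: filterS (near_itv0 xT) => ? /g1.
    move: dC; rewrite (frac_ordE an) => dC; apply: DeriveDef.
      by apply: dC => //; rewrite prednK.
    rewrite -zu// /Caputo /RL_der (frac_ordE an) -/g.
    by rewrite -[in RHS](prednK n0) /= derive1E.
  have : RL_int (n%:R - a) v x @[x --> 0^'+] --> RL_int (n%:R - a) v 0.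
    by apply: cvg_at_right_filter; exact: continuous_RL_int.
  suff -> : RL_int (n%:R - a) v 0 = 0 by [].
  (* For [a = n] the integral has order 0 and its value at 0 is [v 0]; this is where [v 0 = 0]
     enters. *)
  have [->|na] := eqVneq (n%:R - a) 0; first by rewrite RL_int0.
  by rewrite RL_int_at0.
have J1w s : 0 < s < T -> RL_int 1 (RL_int n.-1%:R v) s = RL_int 1 (RL_int a u) s.
  move=> /andP[s0 sT].
  rewrite (RL_int_comp _ ler01 n10 cv) (RL_int_comp _ ler01 a0 cu).
  rewrite [1 + a]addrC.
  rewrite -(RL_int_comp _ a0 ler01 cu).
  have -> : RL_int a (RL_int 1 u) s = RL_int a (RL_int (n%:R - a) v) s.
    apply: (RL_int_eq _ (ltW s0)) => x /andP[x0 xs].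
    by rewrite Jv// x0 (le_trans xs (ltW sT)).
  rewrite (RL_int_comp _ a0 na0 cv) [1 + _]addrC n1E addrC subrK.
  by [].
have wu s : 0 <= s <= T -> w s = RL_int a u s.
  move=> sT; rewrite wJ//; move: s sT; apply: eq_closed_itv => //; [exact: cJ|exact: cJ|].
  move=> s sT; have s0 : 0 < s by case/andP: sT.
  have dv := is_derive_RL_int1 (continuous_RL_int n10 cv) s0.
  have du := is_derive_RL_int1 (continuous_RL_int a0 cu) s0.
  rewrite -(@derive_val _ _ _ _ _ _ _ dv) -(@derive_val _ _ _ _ _ _ _ du).
  by apply: near_eq_derive; apply: filterS (near_itv0 sT) => x /J1w.
move=> tT; have := wu t tT.
rewrite /w /y0 /fracsum RL_int_cst0 ?subr0// addr0 => /eqP.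
by rewrite subr_eq addrC => /eqP.
Qed.

End Converse.

(** * The Volterra equation *)

Section GeometricSeries.
Context {R : realType}.
Implicit Types (f : R -> R) (T C D e t x : R) (k n : nat).

Lemma geometric_small C e : 0 < e -> exists n, C * 2^-1 ^+ n < e.
Proof.
move=> e0; exists (Num.Def.archi_bound (C / e)).
rewrite exprVn ltr_pdivrMr ?exprn_gt0// mulrC -ltr_pdivrMr//.
exact: upper_nthrootP.
Qed.

Lemma le_geometric_le0 C x : (forall n, x <= C * 2^-1 ^+ n) -> x <= 0.
Proof.
move=> xC; rewrite leNgt; apply/negP => /(geometric_small C)[n].
by rewrite ltNge xC.
Qed.

(** The point [s] does not depend on [f], so bounds on [[0, T]] pass to constant extensions. *)
Lemma const_ext_in T t : 0 < T ->
  exists2 s, 0 <= s <= T & forall f, const_ext T f t = f s.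
Proof.
move=> T0; rewrite /const_ext; case: (ltP t 0) => t0.
  by exists 0; rewrite ?lexx ?ltW.
case: (ltP T t) => tT; first by exists T; rewrite ?lexx ?ltW.
by exists t; rewrite ?t0.
Qed.

(** The subtracted term lets the induction on [p] close; dropping it leaves a bound uniform in
    [p]. *)
Lemma geometric_partial_sum (c : nat -> R) D n p : 0 <= D ->
  (forall k, `|c k| <= D * 2^-1 ^+ k) ->
  `|\sum_(0 <= k < n + p) c k - \sum_(0 <= k < n) c k| <=
  2 * D * 2^-1 ^+ n - 2 * D * 2^-1 ^+ (n + p).
Proof.
move=> D0 cD; elim: p => [|p IH]; first by rewrite addn0 !subrr normr0.
rewrite addnS big_nat_recr//= addrAC.
apply: le_trans (ler_normD _ _) _; apply: le_trans (lerD IH (cD _)) _.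
by rewrite exprS; lra.
Qed.

(** The Weierstrass test with its rate. With constant extensions of the terms, the bounds hold
    everywhere and the limit is continuous on the whole line. *)
Lemma geometric_series (c : nat -> R -> R) T D : 0 < T -> 0 <= D ->
  (forall k, continuous (c k)) ->
  (forall k t, 0 <= t <= T -> `|c k t| <= D * 2^-1 ^+ k) ->
  exists2 u : R -> R, continuous u &
    forall n t, 0 <= t <= T ->
      `|u t - \sum_(0 <= k < n) c k t| <= 2 * D * 2^-1 ^+ n.
Proof.
move=> T0 D0 cc cD.
pose e k := const_ext T (c k).
have ce k : continuous (e k).
  by apply: continuous_const_ext => //; exact: continuous_subspaceT.
have eD t k : `|e k t| <= D * 2^-1 ^+ k.
  by have [s sT E] := const_ext_in t T0; rewrite /e E; exact: cD.
have tail t n p : `|\sum_(0 <= k < n + p) e k t - \sum_(0 <= k < n) e k t| <=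
    2 * D * 2^-1 ^+ n.
  apply: le_trans (geometric_partial_sum n p D0 (eD t)) _.
  by rewrite gerBl; apply: mulr_ge0; [exact: mulr_ge0|exact: exprn_ge0].
pose S t n := \sum_(0 <= k < n) e k t.
have cvgS t : cvgn (S t).
  apply: (@normed_cvg _ R^o (fun k => e k t)).
  apply: (@series_le_cvg _ _ (geometric D 2^-1)).
  - by move=> k; exact: normr_ge0.
  - by move=> k; rewrite /geometric /= mulr_ge0// exprn_ge0.
  - by move=> k; rewrite /geometric /=; exact: eD.
  - by apply: is_cvg_geometric_series; rewrite ger0_norm// invf_lt1// ltr1n.
pose u t := limn (S t).
have uS n t : `|u t - S t n| <= 2 * D * 2^-1 ^+ n.
  have h : `|S t k - S t n| @[k --> \oo] --> `|u t - S t n|.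
    by apply: cvg_norm; apply: cvgB; [exact: cvgS|exact: cvg_cst].
  rewrite -(cvg_lim _ h)//; apply: limr_le; first exact: (cvgP _ h).
  near=> k; have nk : (n <= k)%N by near: k; exact: nbhs_infty_ge.
  by rewrite -(subnKC nk); exact: tail.
exists u; last first.
  move=> n t tT; rewrite (eq_bigr (fun k => e k t)) ?uS// => k _.
  by rewrite /e const_extE.
move=> x; apply/cvgrPdist_lt => d d0.
have d3 : 0 < d / 3 by rewrite divr_gt0.
have [n nd] := geometric_small (2 * D) d3.
have cS : continuous (fun t => S t n) by apply: continuous_sum.
have /cvgrPdist_lt/(_ _ d3) cSx := cS x.
near=> y.
have := uS n x; have := uS n y.
have : `|S x n - S y n| < d / 3 by near: y.
rewrite (_ : u x - u y = (u x - S x n) + (S x n - S y n) - (u y - S y n)); last by ring.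
move=> h1 h2 h3; apply: le_lt_trans (ler_normB _ _) _.
have := ler_normD (u x - S x n) (S x n - S y n).
by lra.
Unshelve. all: by end_near. Qed.

End GeometricSeries.

(** * Contraction and Neumann series *)

Section Volterra.
Context {R : realType}.
Variables (T : R) (m : nat) (alpha : nat -> R) (a : nat -> R -> R) (delta : R).
Hypotheses (T0 : 0 < T) (delta0 : 0 < delta).
Hypothesis alphaP : forall i, (1 <= i < m.+1)%N -> delta <= alpha 0%N - alpha i.
Hypothesis alpha0 : 0 <= alpha 0%N.
Hypothesis ca : forall i, (1 <= i < m.+1)%N -> continuous (a i).
Implicit Types (g h F u d : R -> R) (l K t x : R) (k N : nat).

Local Notation B := (bracket_op m alpha a).

Let alpha_ge0 i : (1 <= i < m.+1)%N -> 0 <= alpha 0%N - alpha i.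
Proof. by move=> /alphaP; apply: le_trans; exact: ltW. Qed.

Lemma bracket_opE g : B g = fun t =>
  \sum_(1 <= i < m.+1 | (1 <= i < m.+1)%N) a i t * RL_int (alpha 0%N - alpha i) g t.
Proof. by apply/funext => t; rewrite /bracket_op big_nat. Qed.

Lemma continuous_bracket_op g : continuous g -> continuous (B g).
Proof.
move=> cg; rewrite bracket_opE; apply: continuous_sum => i im x.
by apply: cvgM; [exact: ca|exact: (continuous_RL_int (alpha_ge0 im) cg)].
Qed.

Lemma bracket_op_sum (r : seq nat) (c : nat -> R) (g : nat -> R -> R) t :
  (forall k, continuous (g k)) ->
  B (fun x => \sum_(k <- r) c k * g k x) t = \sum_(k <- r) c k * B (g k) t.
Proof.
move=> cg; rewrite bracket_opE.
under eq_bigr => i im do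
  rewrite (RL_int_sum _ _ _ (alpha_ge0 im) (fun k _ => cg k)) mulr_sumr.
rewrite exchange_big /=; apply: eq_bigr => k _.
by rewrite bracket_opE mulr_sumr; apply: eq_bigr => i im; ring.
Qed.

Lemma bracket_opB g h t : continuous g -> continuous h ->
  B (fun x => g x - h x) t = B g t - B h t.
Proof.
move=> cg ch; rewrite !bracket_opE -sumrB; apply: eq_bigr => i im.
have -> : (fun x => g x - h x) = (fun x => 1 * g x + (-1) * h x).
  by apply/funext => x; ring.
by rewrite (RL_int_lin _ _ _ (alpha_ge0 im) cg ch); ring.
Qed.

Lemma continuous_iter_bracket F k : continuous F -> continuous (iter k B F).
Proof. by move=> cF; elim: k => //= k; exact: continuous_bracket_op. Qed.

Lemma bracket_op_eq g h t : 0 <= t -> (forall x, 0 <= x <= t -> g x = h x) ->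
  B g t = B h t.
Proof.
move=> t0 gh; apply: eq_bigr => i _.
by rewrite (RL_int_eq _ t0 gh).
Qed.

(** In the norm [sup e^(-l t) |g t|] the operator [I^b] has norm at most
    [l^(-b)], hence the choice [l^delta = 2 m M + 1]. *)
Lemma bracket_op_contraction : exists2 l, 0 < l & forall g K t, 0 <= t <= T ->
  continuous g -> (forall x, 0 <= x <= t -> `|g x| <= K * expR (l * x)) ->
  `|B g t| <= K * 2^-1 * expR (l * t).
Proof.
have [M M0 aM] : exists2 M, 0 <= M & forall i t, (1 <= i < m.+1)%N ->
    0 <= t <= T -> `|a i t| <= M.
  elim: m ca => [|p IH] cap; first by exists 0 => // i t; case: i.
  have [|M M0 aM] := IH.
    by move=> i /andP[i1 ip]; apply: cap; rewrite i1 ltnS ltnW.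
  have cp : continuous (a p.+1) by apply: cap; rewrite /= ltnSn.
  have [M' M'0 aM'] := continuous_bounded_itv 0 T cp.
  exists (M + M') => [|i t /andP[i1]]; first by rewrite addr_ge0.
  rewrite ltnS leq_eqVlt => /predU1P[->|ip] tT.
    by apply: le_trans (aM' _ tT) _; rewrite lerDr.
  by apply: le_trans (aM i t _ tT) _; rewrite ?i1 ?lerDl.
pose X := 2 * m%:R * M + 1.
(* The summand 1 in [X] ensures [l >= 1], so that each l^(-(alpha_0 - alpha_i)) is at most
   l^(-delta). *)
have X1 : 1 <= X by rewrite lerDr !mulr_ge0.
have X0 : 0 < X by rewrite (lt_le_trans ltr01).
pose l := X `^ delta^-1.
have l0 : 0 < l by rewrite powR_gt0.
have l1 : 1 <= l.
  have : 1 `^ delta^-1 <= X `^ delta^-1.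
    by apply: ge0_ler_powR; rewrite ?nnegrE ?invr_ge0 ?(ltW delta0) ?(ltW X0).
  by rewrite powR1.
exists l => // g K t /andP[t0 tT] cg gK.
have K0 : 0 <= K.
  have := gK 0; rewrite lexx t0 mulr0 expR0 mulr1 => /(_ isT).
  exact: le_trans.
apply: (@le_trans _ _ (\sum_(1 <= i < m.+1 | (1 <= i < m.+1)%N)
    M * (K * (X^-1 * expR (l * t))))).
  rewrite bracket_opE; apply: le_trans (ler_norm_sum _ _ _) _.
  apply: ler_sum => i im; rewrite normrM; apply: ler_pM => //.
    by apply: aM; rewrite ?t0.
  apply: le_trans (RL_int_le_exp (alpha_ge0 im) l0 t0 cg gK) _.
  apply: ler_wpM2l => //; apply: ler_wpM2r; first exact: expR_ge0.
  have -> : X^-1 = l `^ (- delta).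
    by rewrite /l -powRrM mulrN mulVf ?gt_eqF// powR_inv1 ?ltW.
  by apply: ler_powR => //; rewrite lerN2 alphaP.
rewrite -big_nat sumr_const_nat subSS subn0 -[leLHS]mulr_natr.
have mMX : M * m%:R * X^-1 <= 2^-1.
  by rewrite ler_pdivrMr// /X; lra.
have h := ler_wpM2l (mulr_ge0 K0 (expR_ge0 (l * t))) mMX.
rewrite (mulrAC K); apply: (le_trans _ h); rewrite le_eqVlt.
by apply/orP; left; apply/eqP; ring.
Qed.

Lemma iter_bracket_bound : exists2 l, 0 < l & forall F K k t, 0 <= K ->
  continuous F -> (forall x, 0 <= x <= T -> `|F x| <= K) -> 0 <= t <= T ->
  `|iter k B F t| <= K * 2^-1 ^+ k * expR (l * t).
Proof.
have [l l0 contr] := bracket_op_contraction.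
exists l => // F K k t K0 cF FK; elim: k t => [|k IH] t tT /=.
  rewrite expr0 mulr1; apply: le_trans (FK t tT) _.
  rewrite -[leLHS]mulr1 ler_wpM2l// -expR0 ler_expR mulr_ge0 ?(ltW l0)//.
  by case/andP: tT.
rewrite exprSr mulrA; apply: contr => //; first exact: continuous_iter_bracket.
move=> x /andP[x0 xt]; apply: IH; rewrite x0 (le_trans xt)//.
by case/andP: tT.
Qed.

(** Iterating the equation gives d = (-1)^k B^k d for every [k], and the right side is O(2^(-k)). *)
Lemma Volterra_unique d : continuous d ->
  (forall t, 0 <= t <= T -> d t = - B d t) -> forall t, 0 <= t <= T -> d t = 0.
Proof.
move=> cd dB t tT; have [l l0 bnd] := iter_bracket_bound.
have [M M0 dM] := continuous_bounded_itv 0 T cd.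
have dk k x : 0 <= x <= T -> d x = (-1) ^+ k * iter k B d x.
  elim: k x => [|k IH] x xT /=; first by rewrite mul1r.
  rewrite dB// (_ : B d x = (-1) ^+ k * B (iter k B d) x); first by rewrite exprS mulN1r mulNr.
  have ci : nat -> continuous (iter k B d).
    by move=> ?; exact: continuous_iter_bracket.
  (* A sum with a single term yields the homogeneity of [B]. *)
  have := @bracket_op_sum [:: 0%N] (fun=> (-1) ^+ k) (fun=> iter k B d) x ci.
  rewrite big_seq1 => <-; apply: bracket_op_eq; first by case/andP: xT.
  move=> s /andP[s0 sx]; rewrite big_seq1; apply: IH.
  by rewrite s0 (le_trans sx)//; case/andP: xT.
apply/eqP; rewrite -normr_le0; apply: (@le_geometric_le0 _ (M * expR (l * t))).
move=> k; rewrite (dk k)// normrM normrX normrN1 expr1n mul1r mulrAC.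
exact: bnd.
Qed.

Variable F : R -> R.
Hypothesis cF : continuous F.

Definition Neumann k t := (-1) ^+ k.+1 * iter k B F t.

Let cN k : continuous (Neumann k).
Proof.
move=> t; apply: cvgM; first exact: cvg_cst.
exact: continuous_iter_bracket.
Qed.

Let cS N : continuous (fun t => \sum_(0 <= k < N) Neumann k t).
Proof. exact: continuous_sum. Qed.

Let Neumann_rec N t : \sum_(0 <= k < N.+1) Neumann k t =
  - F t - B (fun x => \sum_(0 <= k < N) Neumann k x) t.
Proof.
rewrite bracket_op_sum; last by move=> k; exact: continuous_iter_bracket.
rewrite big_nat_recl//= /Neumann expr1 mulN1r -sumrN; congr (_ + _).
by apply: eq_bigr => k _; rewrite exprS mulN1r mulNr.
Qed.

(** The partial sums satisfy S_(N+1) = - F - B S_N, and u - S_N is O(2^(-N)) uniformly on [[0, T]].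
    Both [B] and I^(alpha_0) keep this rate, which gives the equation and the termwise
    integration. *)
Lemma Volterra_solution : exists u, [/\ continuous u,
  forall t, 0 <= t <= T -> u t = - F t - B u t &
  forall t, 0 <= t <= T ->
    RL_int (alpha 0%N) (fun x => \sum_(0 <= k < N) Neumann k x) t @[N --> \oo]
      --> RL_int (alpha 0%N) u t].
Proof.
have [l l0 bnd] := iter_bracket_bound.
have [lc lc0 contr] := bracket_op_contraction.
have [M M0 FM] := continuous_bounded_itv 0 T cF.
pose D := M * expR (l * T).
have D0 : 0 <= D by rewrite mulr_ge0// expR_ge0.
have ND k t : 0 <= t <= T -> `|Neumann k t| <= D * 2^-1 ^+ k.
  move=> tT; rewrite normrM normrX normrN1 expr1n mul1r.
  apply: le_trans (bnd _ _ k t M0 cF FM tT) _; rewrite mulrAC ler_wpM2r ?exprn_ge0//.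
  by rewrite ler_wpM2l// ler_expR ler_wpM2l ?(ltW l0)//; case/andP: tT.
have [u cu uS] := geometric_series T0 D0 cN ND.
pose S N x := \sum_(0 <= k < N) Neumann k x.
have cuS N : continuous (fun x => u x - S N x).
  by move=> x; apply: cvgB; [exact: cu|exact: cS].
(* The exponent [c] stays free: the contraction imposes [lc], while 1 is enough for I^(alpha_0). *)
have err N c t : 0 < c -> 0 <= t <= T -> forall x, 0 <= x <= t ->
    `|u x - S N x| <= 2 * D * 2^-1 ^+ N * expR (c * x).
  move=> c0 /andP[_ tT] x /andP[x0 xt].
  apply: le_trans (uS N x _) _; first by rewrite x0 (le_trans xt).
  rewrite -[leLHS]mulr1 ler_wpM2l//.
    by apply: mulr_ge0; [exact: mulr_ge0|exact: exprn_ge0].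
  by rewrite -expR0 ler_expR mulr_ge0// ltW.
exists u; split => //.
- move=> t tT; have t0 : 0 <= t by case/andP: tT.
  apply/eqP; rewrite -subr_eq0 -normr_le0.
  apply: (@le_geometric_le0 _ (2 * D + 2 * D * expR (lc * t))) => N.
  have -> : u t - (- F t - B u t) =
      (u t - S N.+1 t) + B (fun x => u x - S N x) t.
    have SN : S N.+1 t = - F t - B (S N) t by exact: Neumann_rec.
    by rewrite (bracket_opB t cu (@cS N)) SN; ring.
  apply: le_trans (ler_normD _ _) _; rewrite mulrDl; apply: lerD.
    apply: le_trans (uS N.+1 t tT) _; rewrite ler_wpM2l ?mulr_ge0//.
    by rewrite exprS ler_piMl ?exprn_ge0// invf_le1// ler1n.
  apply: le_trans (contr _ _ _ tT (cuS N) (err N lc t lc0 tT)) _.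
  have : 0 <= D * 2^-1 ^+ N * expR (lc * t).
    by rewrite mulr_ge0 ?expR_ge0// mulr_ge0// exprn_ge0.
  by move: (2^-1 ^+ N) (expR _) => p q; lra.
- move=> t tT; have t0 : 0 <= t by case/andP: tT.
  apply/cvgrPdist_lt => e e0.
  have [N0 N0e] := geometric_small (2 * D * (1 `^ (- alpha 0%N) * expR (1 * t))) e0.
  near=> N; have NN : (N0 <= N)%N by near: N; exact: nbhs_infty_ge.
  have -> : RL_int (alpha 0%N) u t - RL_int (alpha 0%N) (S N) t =
      RL_int (alpha 0%N) (fun x => u x - S N x) t.
    have -> : (fun x => u x - S N x) = (fun x => 1 * u x + (-1) * S N x).
      by apply/funext => x; ring.
    by rewrite (RL_int_lin _ _ _ alpha0 cu (@cS N)); ring.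
  have := RL_int_le_exp alpha0 ltr01 t0 (cuS N) (err N 1 t ltr01 tT).
  move=> /le_lt_trans; apply; apply: le_lt_trans N0e.
  rewrite mulrAC; apply: ler_wpM2l.
    by rewrite mulr_ge0 ?mulr_ge0 ?expR_ge0 ?powR_ge0.
  by rewrite ler_wiXn2l// ?invf_le1 ?ler1n// invr_ge0.
Unshelve. all: by end_near. Qed.

End Volterra.

(** * The initial value problem *)

Lemma itv_oocc (R : realType) (T t : R) : 0 < t < T -> 0 <= t <= T.
Proof. by move=> /andP[? ?]; rewrite !ltW. Qed.

Section InitialValueProblem.
Context {R : realType}.

Lemma fracsum_delta n k j (s a : R) (u : R -> R) (t : R) : (j < n)%N ->
  fracsum n k (fun l => (l == j)%:R) s a u t =
  (if (k <= j)%N then RL_int (j%:R - s) (cst 1) t else 0) + RL_int (a - s) u t.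
Proof.
move=> jn; rewrite /fracsum; congr (_ + _).
case: ifPn => [kj|]; last first.
  rewrite -ltnNge => jk; rewrite big_nat big1// => l /andP[kl _].
  by rewrite gtn_eqF ?mul0r// (leq_trans jk).
rewrite (bigD1_seq j) ?iota_uniq//=; last by rewrite mem_index_iota kj.
rewrite eqxx mul1r big1 ?addr0// => l /negbTE ->.
by rewrite mul0r.
Qed.

Lemma fracsum_superpose n k (b : nat -> R) (s a : R) (u : nat -> R -> R) (t : R) :
  s <= a -> (forall j, continuous (u j)) ->
  \sum_(0 <= j < n) b j * fracsum n k (fun l => (l == j)%:R) s a (u j) t =
  fracsum n k b s a (fun x => \sum_(0 <= j < n) b j * u j x) t.
Proof.
move=> sa cu; have as0 : 0 <= a - s by rewrite subr_ge0.
rewrite /fracsum (RL_int_sum _ _ _ as0 (fun j _ => cu j)).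
rewrite (eq_big_nat _ _ (F2 := fun j =>
  (if (k <= j)%N then b j * RL_int (j%:R - s) (cst 1) t else 0) +
  b j * RL_int (a - s) (u j) t)).
  rewrite big_split/=; congr (_ + _).
  by rewrite -big_mkcond/= [RHS](@big_nat_widenl _ _ _ k 0).
move=> j /andP[_ jn]; rewrite -/(fracsum _ _ _ _ _ _ _) fracsum_delta// mulrDr.
by case: ifP => // _; rewrite mulr0.
Qed.

Variables (T : R) (m : nat) (alpha : nat -> R) (n : nat -> nat) (a : nat -> R -> R).
Hypotheses (T0 : 0 < T) (m0 : (1 <= m)%N).
Hypothesis alpha_decr : forall i, (i < m)%N -> alpha i.+1 < alpha i.
Hypothesis alpham : 0 <= alpha m.
Hypothesis hn : forall i, (i <= m)%N -> (n i)%:R - 1 < alpha i <= (n i)%:R.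
Hypothesis n10 : (n 1%N < n 0%N)%N.
Hypothesis ca : forall i, (1 <= i <= m)%N -> {within `[0, T], continuous (a i)}.

Lemma alpha_le i j : (i <= j)%N -> (j <= m)%N -> alpha j <= alpha i.
Proof.
elim: j => [|j IH]; first by rewrite leqn0 => /eqP ->.
rewrite leq_eqVlt => /predU1P[->//|ij] jm.
by apply: le_trans (ltW (alpha_decr jm)) _; apply: IH => //; exact: ltnW.
Qed.

Lemma alpha_leq_nat i j : (i <= m)%N -> (alpha i <= j%:R) = (n i <= j)%N.
Proof.
move=> im; have /andP[ni1 ni2] := hn im; apply/idP/idP => [ij|nij].
  have := lt_le_trans ni1 ij; rewrite ltrBlDr natr1 ltr_nat ltnS.
  by [].
by apply: le_trans ni2 _; rewrite ler_nat.
Qed.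

Lemma ord_le i j : (i <= j)%N -> (j <= m)%N -> (n j <= n i)%N.
Proof.
move=> ij jm; rewrite -alpha_leq_nat// (le_trans (alpha_le ij jm))//.
by case/andP: (hn (leq_trans ij jm)).
Qed.

Let ae i := const_ext T (a i).

Let cae i : (1 <= i < m.+1)%N -> continuous (ae i).
Proof. by move=> im; apply: continuous_const_ext => //; exact: ca. Qed.

Let alpha0_ge0 : 0 <= alpha 0%N.
Proof. by apply: le_trans alpham _; exact: alpha_le. Qed.

Let gap : 0 < alpha 0%N - alpha 1%N.
Proof. by rewrite subr_gt0; exact: alpha_decr. Qed.

Let alpha_gap i : (1 <= i < m.+1)%N ->
  alpha 0%N - alpha 1%N <= alpha 0%N - alpha i.
Proof. by move=> /andP[i1 im]; rewrite lerB// alpha_le. Qed.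

Let an0 : (n 0%N)%:R - 1 < alpha 0%N <= (n 0%N)%:R. Proof. exact: hn. Qed.

Let n0_gt0 : (0 < n 0%N)%N. Proof. exact: leq_ltn_trans n10. Qed.

Let le_alpha i : (1 <= i < m.+1)%N -> alpha i <= alpha 0%N.
Proof. by move=> /andP[i1 im]; exact: alpha_le. Qed.

(** The sum of the a_i cD^(alpha_i) y when [y] has initial values [b] and Caputo derivative [u]:
    both F and B u of the Volterra equation, which reads [u = - forcing b u]. *)
Definition forcing (b : nat -> R) (u : R -> R) (t : R) : R :=
  \sum_(1 <= i < m.+1) ae i t *
    fracsum (n 0%N) (n i) b (alpha i) (alpha 0%N) u t.

Lemma continuous_forcing b u : continuous u -> continuous (forcing b u).
Proof.
move=> cu.
have -> : forcing b u = fun t => \sum_(1 <= i < m.+1 | (1 <= i < m.+1)%N)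
    ae i t * fracsum (n 0%N) (n i) b (alpha i) (alpha 0%N) u t.
  by apply/funext => t; rewrite /forcing big_nat.
apply: continuous_sum => i im x; apply: cvgM; first exact: cae.
apply: (continuous_fracsum _ (le_alpha im) cu).
by case/andP: im => _ im; case/andP: (hn im).
Qed.

Lemma rep_Caputo_i b u y i : (1 <= i < m.+1)%N -> continuous u ->
  (forall t, 0 <= t <= T -> y t = fracsum (n 0%N) 0 b 0 (alpha 0%N) u t) ->
  forall t, 0 < t < T -> Caputo (alpha i) y t =
    fracsum (n 0%N) (n i) b (alpha i) (alpha 0%N) u t.
Proof.
move=> im cu yE; case/andP: an0 => an1 _; case/andP: (im) => i1 im'.
have [_] := rep_Caputo T0 n0_gt0 an1 cu yE (hn im') (ord_le (leq0n i) im') (le_alpha im).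
by [].
Qed.

Lemma rep_Caputo0 b u y : continuous u ->
  (forall t, 0 <= t <= T -> y t = fracsum (n 0%N) 0 b 0 (alpha 0%N) u t) ->
  n_derivable T (frac_ord (alpha 0%N))
    (RL_int ((frac_ord (alpha 0%N))%:R - alpha 0%N)
      (sub_Taylor0 (frac_ord (alpha 0%N)) y)) /\
  forall t, 0 < t < T -> Caputo (alpha 0%N) y t = u t.
Proof.
move=> cu yE; case/andP: (an0) => an1 _.
have [dy Cy] := rep_Caputo T0 n0_gt0 an1 cu yE an0 (leqnn _) (lexx _).
by split=> // t tT; rewrite Cy// /fracsum big_geq// add0r subrr RL_int0.
Qed.

Lemma rep_is_solution b u y : continuous u ->
  (forall t, 0 <= t <= T -> y t = fracsum (n 0%N) 0 b 0 (alpha 0%N) u t) ->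
  (forall t, 0 < t < T -> u t = - forcing b u t) ->
  is_solution T m alpha (n 0%N) a b y.
Proof.
move=> cu yE uE; have [dy Cy] := rep_Caputo0 cu yE.
case/andP: (an0) => an1 _; split.
- split => //; first exact: rep_C_n n0_gt0 an1 cu yE.
  by exists u; split=> //; exact: continuous_subspaceT.
- move=> t tT; rewrite Cy// uE// /forcing !big_nat; congr (- _).
  apply: eq_bigr => i im; rewrite (rep_Caputo_i im cu yE)// /ae const_extE//.
  exact: itv_oocc.
- by move=> k kn; exact: (rep_right0 T0 n0_gt0 an1 cu yE).
Qed.

(** [u] is the continuous extension of the Caputo derivative; by continuity, the equation on []0,
    T[] reaches the end points. *)
Lemma solution_rep b z : is_solution T m alpha (n 0%N) a b z ->
  exists u, [/\ continuous u,
    forall t, 0 <= t <= T -> z t = fracsum (n 0%N) 0 b 0 (alpha 0%N) u t &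
    forall t, 0 <= t <= T -> u t = - forcing b u t].
Proof.
move=> [zC zeq zb]; have [_ _ [G [cG GE]]] := zC.
have cu := continuous_const_ext T0 cG.
have uE t : 0 < t < T -> Caputo (alpha 0%N) z t = const_ext T G t.
  by move=> tT; rewrite GE// const_extE//; exact: itv_oocc.
have zE := Caputo_rep T0 n0_gt0 an0 cu zC zb uE.
exists (const_ext T G); split => //.
apply: eq_closed_itv => //; try exact: continuous_subspaceT.
  apply: continuous_subspaceT => x; apply: cvgN; exact: continuous_forcing.
move=> t tT; rewrite -uE// zeq// /forcing !big_nat; congr (- _).
apply: eq_bigr => i im; rewrite (rep_Caputo_i im cu zE)// /ae const_extE//.
exact: itv_oocc.
Qed.

Lemma forcingB b u v t : continuous u -> continuous v ->
  forcing b u t - forcing b v t = bracket_op m alpha ae (fun x => u x - v x) t.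
Proof.
move=> cu cv; rewrite (bracket_opB ae gap alpha_gap t cu cv) /forcing /bracket_op.
rewrite -!sumrB; apply: eq_bigr => i _; rewrite /fracsum; ring.
Qed.

Lemma forcing_unique b u v : continuous u -> continuous v ->
  (forall t, 0 <= t <= T -> u t = - forcing b u t) ->
  (forall t, 0 <= t <= T -> v t = - forcing b v t) ->
  forall t, 0 <= t <= T -> u t = v t.
Proof.
move=> cu cv uE vE t tT; apply/eqP; rewrite -subr_eq0; apply/eqP.
apply: (@Volterra_unique _ T m alpha ae _ gap alpha_gap cae
  (fun x => u x - v x)) => //.
  by move=> x; apply: cvgB; [exact: cu|exact: cv].
by move=> x xT; rewrite -(forcingB b)// {1}uE// {1}vE//; ring.
Qed.

(** The term F for the initial values of [y_j]: the Caputo derivative of order alpha_i kills t^j /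
    j! unless [n i <= j]. *)
Definition source (j : nat) (t : R) : R :=
  \sum_(1 <= i < m.+1 | (n i <= j)%N) ae i t * RL_int (j%:R - alpha i) (cst 1) t.

Lemma continuous_source j : continuous (source j).
Proof.
have -> : source j = fun t => \sum_(1 <= i < m.+1 | (1 <= i < m.+1)%N && (n i <= j)%N)
    ae i t * RL_int (j%:R - alpha i) (cst 1) t.
  by apply/funext => t; rewrite /source big_nat_cond.
apply: continuous_sum => i /andP[im nij] x; apply: cvgM; first exact: cae.
apply: continuous_RL_int; last exact: cst_continuous.
by rewrite subr_ge0 alpha_leq_nat//; case/andP: im.
Qed.

Lemma forcing_delta j u t : (j < n 0%N)%N ->
  forcing (fun l => (l == j)%:R) u t = source j t + bracket_op m alpha ae u t.
Proof.
move=> jn; rewrite /forcing /source [in RHS]big_mkcond/= /bracket_op -big_split/=.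
apply: eq_bigr => i _; rewrite fracsum_delta// mulrDr; congr (_ + _).
by case: ifP => // _; rewrite mulr0.
Qed.

(** Each fractional integral reads only [[0, x]], so by induction on the power [a] may be replaced
    by its extension and the inner sum by [F]; linearity then merges the integrals. *)
Lemma fund_partial_eq h j N t (F : R -> R) : continuous F -> 0 <= t <= T ->
  (forall x, 0 <= x <= T ->
    \sum_(h <= i < m.+1) a i x * Phi (j.+1%:R - alpha i) x = F x) ->
  fund_partial m alpha a h j t N = RL_int j%:R (cst 1) t +
    RL_int (alpha 0%N) (fun x => \sum_(0 <= k < N) Neumann m alpha ae F k x) t.
Proof.
move=> cF tT FE; have t0 : 0 <= t by case/andP: tT.
have ci k : continuous (iter k (bracket_op m alpha ae) F).
  exact: (continuous_iter_bracket gap alpha_gap cae).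
rewrite /fund_partial RL_int_cst1// natr1; congr (_ + _).
rewrite /Neumann (RL_int_sum _ _ _ alpha0_ge0 (fun k _ => ci k)).
apply: eq_bigr => k _; congr (_ * _).
apply: RL_int_eq => // x /andP[x0 xt].
have {x0 xt} : 0 <= x <= T by rewrite x0 (le_trans xt)//; case/andP: tT.
elim: k x => [|k IH] x xT /=; first exact: FE.
rewrite /bracket_op !big_nat; apply: eq_bigr => i im.
rewrite {1}/ae const_extE//; congr (_ * _).
apply: RL_int_eq; first by case/andP: xT.
move=> y /andP[y0 yx]; apply: IH; rewrite y0 (le_trans yx)//.
by case/andP: xT.
Qed.

Lemma source_Phi j x : 0 <= x <= T ->
  source j x =
  \sum_(1 <= i < m.+1 | (n i <= j)%N) a i x * Phi (j.+1%:R - alpha i) x.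
Proof.
move=> xT; rewrite /source big_nat_cond [RHS]big_nat_cond.
apply: eq_bigr => i /andP[im nij]; rewrite /ae const_extE//.
rewrite RL_int_cst1; last by case/andP: xT.
  by rewrite -natr1 addrAC.
by rewrite subr_ge0 alpha_leq_nat//; case/andP: im.
Qed.

Lemma mem_Hset j k :
  (k \in Hset m alpha j) = (1 <= k <= m)%N && (n k <= j)%N.
Proof.
rewrite mem_filter mem_iota add1n ltnS andbC.
case: (boolP (1 <= k <= m)%N) => //= /andP[k1 km].
rewrite -alpha_leq_nat// andb_idl// => _.
by rewrite (le_trans alpham)// alpha_le.
Qed.

(** As alpha decreases, H_j is closed upwards: it consists of all indices from its minimum to
    [m]. *)
Lemma hminP j i : Hset m alpha j <> [::] -> (1 <= i <= m)%N ->
  (hmin m alpha j <= i)%N = (n i <= j)%N.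
Proof.
move=> Hj /andP[i1 im].
have [h hH hle] : exists2 h, h \in Hset m alpha j &
    forall k, k \in Hset m alpha j -> (h <= k)%N.
  case E : (Hset m alpha j) Hj => [//|k s] _.
  have : exists k, k \in Hset m alpha j by exists k; rewrite E mem_head.
  by move=> /ex_minnP[h hH hle]; exists h; rewrite -?E// => ?; rewrite -E; exact: hle.
have hm : (h <= m)%N by move: hH; rewrite mem_Hset => /andP[/andP[]].
have -> : hmin m alpha j = h.
  apply/eqP; rewrite eqn_leq /hmin; apply/andP; split.
    elim: (Hset m alpha j) hH => // k s IH.
    rewrite in_cons big_cons geq_min => /predU1P[->|/IH ->].
      by rewrite leqnn.
    by rewrite orbT.
  rewrite big_seq; elim/big_ind: _ => // x y hx hy.
  by rewrite leq_min hx.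
apply/idP/idP => [hi|nij].
  by move: hH; rewrite mem_Hset => /andP[_]; apply: leq_trans; exact: ord_le.
by apply: hle; rewrite mem_Hset i1 im.
Qed.

Lemma hmin_gt0 j : (0 < hmin m alpha j)%N.
Proof.
rewrite /hmin big_seq; elim/big_ind: _ => // [x y x0 y0|i].
  by rewrite leq_min x0.
by rewrite mem_Hset => /andP[/andP[]].
Qed.

Lemma Hset_eq0 j k : (j <= k)%N -> Hset m alpha k = [::] -> Hset m alpha j = [::].
Proof.
move=> jk Hk; case E : (Hset m alpha j) => [//|i s].
have : i \in Hset m alpha k.
  have : i \in Hset m alpha j by rewrite E mem_head.
  by rewrite !mem_Hset => /andP[-> /leq_trans]; exact.
by rewrite Hk.
Qed.

(** If H_j is empty then the source vanishes, and the homogeneous Volterra equation has only the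
    zero solution. This is why [y_j] reduces to Phi_(j+1). *)
Lemma homogeneous_forcing j u : Hset m alpha j = [::] -> (j < n 0%N)%N ->
  continuous u ->
  (forall t, 0 <= t <= T -> u t = - forcing (fun l => (l == j)%:R) u t) ->
  forall t, 0 <= t <= T -> u t = 0.
Proof.
move=> Hj jn cu uE; apply: (Volterra_unique gap alpha_gap cae cu) => t tT.
rewrite {1}uE// forcing_delta// /source big_nat_cond big1 ?add0r//.
move=> i /andP[/andP[i1 im] nij].
have : i \in Hset m alpha j by rewrite mem_Hset i1 nij andbT.
by rewrite Hj.
Qed.

Lemma forcing_superpose b (u : nat -> R -> R) t : (forall j, continuous (u j)) ->
  forcing b (fun x => \sum_(0 <= j < n 0%N) b j * u j x) t =
  \sum_(0 <= j < n 0%N) b j * forcing (fun l => (l == j)%:R) (u j) t.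
Proof.
move=> cu; rewrite /forcing.
under [RHS]eq_bigr do rewrite mulr_sumr.
rewrite exchange_big/= !big_nat; apply: eq_bigr => i im.
rewrite -(fracsum_superpose _ _ _ _ (le_alpha im) cu) mulr_sumr.
by apply: eq_bigr => j _; ring.
Qed.

(** The lower index [h] is left free so that one clause covers both series: h = h_j, and h = 1 when
    [j >= n 1]. *)
Lemma fundamental_system : exists Y : nat -> R -> R,
  exists u : nat -> R -> R,
  [/\ forall j, continuous (u j),
      forall j t, (j < n 0%N)%N -> Y j t =
        fracsum (n 0%N) 0 (fun l => (l == j)%:R) 0 (alpha 0%N) (u j) t,
      forall j, (j < n 0%N)%N -> forall t, 0 <= t <= T ->
        u j t = - forcing (fun l => (l == j)%:R) (u j) t &
      forall h j, (j < n 0%N)%N ->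
        (forall i, (1 <= i <= m)%N -> (h <= i)%N = (n i <= j)%N) -> (0 < h)%N ->
        forall t, 0 <= t <= T -> fund_partial m alpha a h j t N @[N --> \oo] --> Y j t].
Proof.
have /choice[u uP] : forall j, exists u : R -> R, [/\ continuous u,
    forall t, 0 <= t <= T -> u t = - source j t - bracket_op m alpha ae u t &
    forall t, 0 <= t <= T -> RL_int (alpha 0%N)
      (fun x => \sum_(0 <= k < N) Neumann m alpha ae (source j) k x) t
        @[N --> \oo] --> RL_int (alpha 0%N) u t].
  move=> j.
  exact: (Volterra_solution T0 gap alpha_gap alpha0_ge0 cae (@continuous_source j)).
exists (fun j t => RL_int j%:R (cst 1) t + RL_int (alpha 0%N) (u j) t), u; split.
- by move=> j; case: (uP j).
- by move=> j t jn; rewrite (fracsum_delta _ _ _ _ _ jn) leq0n !subr0.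
- move=> j jn t tT; case: (uP j) => _ uE _.
  by rewrite {1}uE// forcing_delta// opprD.
- move=> h j jn hP h0 t tT; case: (uP j) => _ _ uS.
  have FE N : fund_partial m alpha a h j t N = RL_int j%:R (cst 1) t +
      RL_int (alpha 0%N)
        (fun x => \sum_(0 <= k < N) Neumann m alpha ae (source j) k x) t.
    apply: fund_partial_eq => // [|x xT]; first exact: continuous_source.
    rewrite source_Phi// (big_nat_widenl h 1)//= big_nat_cond [RHS]big_nat_cond.
    by apply: eq_bigl => i; case: (boolP (1 <= i < m.+1)%N) => //= im; exact: hP.
  under eq_fun do rewrite FE.
  by apply: cvgD; [exact: cvg_cst|exact: uS].
Qed.

End InitialValueProblem.

Theorem corollary4 (R : realType) (T : R) (m : nat) (alpha : nat -> R)
    (n : nat -> nat) (a : nat -> R -> R) (j0 : nat) (b : nat -> R)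
    (hT : 0 < T) (hm : (1 <= m)%N)
    (halpha : forall i, (i < m)%N -> alpha i.+1 < alpha i)
    (halpham : 0 <= alpha m)
    (hn : forall i, (i <= m)%N -> (n i)%:R - 1 < alpha i <= (n i)%:R)
    (hn01 : (n 1 < n 0)%N)
    (ha : forall i, (1 <= i <= m)%N -> {within `[0, T], continuous (a i)})
    (hn0 : (2 <= n 0)%N)
    (hj0 : (j0 <= n 0 - 2)%N)
    (hH0 : Hset m alpha j0 = [::])
    (hH1 : Hset m alpha j0.+1 <> [::]) :
  exists Y : nat -> R -> R,
    [/\ canonical_system T m alpha (n 0%N) a Y,
        forall j, (j <= j0)%N ->
          forall t, 0 <= t <= T -> Y j t = Phi j.+1%:R t,
        forall j, (j0.+1 <= j < n 1)%N ->
          forall t, 0 <= t <= T ->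
            fund_partial m alpha a (hmin m alpha j) j t N @[N --> \oo]
              --> Y j t,
        forall j, (n 1 <= j < n 0)%N ->
          forall t, 0 <= t <= T ->
            fund_partial m alpha a 1 j t N @[N --> \oo] --> Y j t
      & exists y : R -> R,
          [/\ is_solution T m alpha (n 0%N) a b y,
              forall z, is_solution T m alpha (n 0%N) a b z ->
                forall t, 0 <= t <= T -> z t = y t
            & forall t, 0 <= t <= T ->
                y t = \sum_(0 <= j < n 0%N) b j * Y j t]].
Proof.
have [Y [u [cu YE uE YF]]] := fundamental_system hT hm halpha halpham hn ha.
(* For [j >= n 1] every index belongs to H_j, so the inner sum starts at 1. *)
have nij i j : (1 <= i <= m)%N -> (n 1 <= j)%N -> (n i <= j)%N.
  by move=> /andP[i1 im]; apply: leq_trans; exact: (ord_le halpha hn).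
exists Y; split.
- move=> j jn.
  by case: (rep_is_solution hT halpha hn hn01 (cu j) (fun t _ => YE j t jn)
    (fun t tT => uE j jn t (itv_oocc tT))).
- move=> j jj0 t tT; have jn : (j < n 0%N)%N.
    apply: leq_ltn_trans jj0 _; apply: leq_ltn_trans hj0 _.
    by rewrite ltn_subrL (leq_trans _ hn0).
  have Hj := Hset_eq0 halpha halpham hn jj0 hH0.
  have u0 := homogeneous_forcing hT hm halpha halpham hn ha Hj jn (cu j) (uE j jn).
  have /andP[t0 tT'] := tT.
  have a0 : 0 <= alpha 0%N by apply: le_trans halpham _; exact: (alpha_le halpha).
  rewrite (YE _ _ jn) (fracsum_delta _ _ _ _ _ jn) leq0n !subr0.
  rewrite (RL_int_cst1 (ler0n _ j) t0) natr1 -[RHS]addr0; congr (_ + _).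
  rewrite -(RL_int_cst0 t a0); apply: (RL_int_eq _ t0) => x /andP[x0 xt].
  by apply: u0; rewrite x0 (le_trans xt).
- move=> j /andP[j0j jn1]; apply: YF; first exact: ltn_trans hn01.
    move=> i im; apply: (hminP halpha halpham hn) im.
    by move=> Hj; apply: hH1; exact: (Hset_eq0 halpha halpham hn j0j).
  exact: (hmin_gt0 hm halpha halpham hn).
- move=> j /andP[n1j jn]; apply: YF => // i im.
  by rewrite nij//; case/andP: im.
(* [forcing] is linear in the pair of initial values and density, so [U] is the density that belongs
   to [b]. Uniqueness is decided on densities: that of any other solution agrees with [U] on
   [[0, T]]. *)
pose U x := \sum_(0 <= j < n 0%N) b j * u j x.
have cU : continuous U.
  by apply: continuous_sum => j _ x; apply: cvgM; [exact: cvg_cst|exact: cu].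
have a0 : 0 <= alpha 0%N by apply: le_trans halpham _; exact: (alpha_le halpha).
have UE t : 0 <= t <= T -> U t = - forcing T m alpha n a b U t.
  move=> tT; rewrite (forcing_superpose _ _ _ halpha _ _ cu) -sumrN /U !big_nat.
  by apply: eq_bigr => j jn; rewrite {1}uE// mulrN.
have yE t : \sum_(0 <= j < n 0%N) b j * Y j t = fracsum (n 0%N) 0 b 0 (alpha 0%N) U t.
  rewrite -(fracsum_superpose _ _ _ _ a0 cu) !big_nat.
  by apply: eq_bigr => j jn; rewrite YE.
exists (fun t => \sum_(0 <= j < n 0%N) b j * Y j t); split => //.
  by apply: (rep_is_solution hT halpha hn hn01 cU) => // t /itv_oocc /UE.
move=> z /(solution_rep hT halpha hn hn01 ha)[v [cv zE vE]] t tT.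
have vU := forcing_unique hT hm halpha ha cv cU vE UE.
rewrite zE// yE /fracsum; congr (_ + _).
have /andP[t0 tT'] := tT; apply: (RL_int_eq _ t0) => x /andP[x0 xt].
by apply: vU; rewrite x0 (le_trans xt).
Qed.
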